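(* Let $G$ be a group of order $2^n$ with $n\geq 1$. Then: (1) if $1\leq n\leq 3$, then $G$ is DS; (2) if $n=4$, then $G$ is Cay-DS if and only if $G$ is isomorphic to $C_2\times Q_8=\langle a,b,c\mid c^2=1,\ a^2=b^2=b^{-2},\ a^{-1}ba=b^{-1},\ ac=ca,\ bc=cb\rangle$ or to $\langle a,b,c\mid a^2=b^2=c^4=1,\ ac=ca,\ bc=cb,\ c^2=(ba)^2\rangle$ (a group of the form $(C_4\times C_2):C_2$); (3) if $n\geq 5$, then $G$ is not Cay-DS.
   Context: For a finite group $G$ and a subset $S\subseteq G\setminus\{1\}$ with $S=S^{-1}$, the Cayley graph $Cay(G,S)$ has vertex set $G$, with $a,b$ adjacent iff $ab^{-1}\in S$. The spectrum of a graph is the multiset of eigenvalues of its adjacency matrix. A finite group $G$ is DS if every Cayley graph $\Gamma$ on $G$ is isomorphic to every (finite simple) graph $\Gamma'$ with the same spectrum; $G$ is Cay-DS if every Cayley graph $\Gamma$ on $G$ is isomorphic to every Cayley graph $\Gamma'$ (on any finite group) with the same spectrum. $Q_8$ is the quaternion group of order $8$. *)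

(* Defs.v *)
From HB Require Import structures.
From mathcomp Require Import all_boot all_order all_fingroup all_algebra.
From mathcomp Require Import all_solvable all_field.

Set Implicit Arguments.
Unset Strict Implicit.
Unset Printing Implicit Defensive.

Import GroupScope GRing.Theory.

Definition simple_graph (T : finType) (e : rel T) : Prop :=
  symmetric e /\ irreflexive e.

Definition graph_iso (T T' : finType) (e : rel T) (e' : rel T') : Prop :=
  exists2 f : T -> T', bijective f & forall x y, e' (f x) (f y) = e x y.

Definition adjacency_mx (T : finType) (e : rel T) : 'M[algC]_#|T| :=
  (\matrix_(i, j) (e (enum_val i) (enum_val j))%:R)%R.

(* The eigenvalues are algebraic over the rationals, so algC contains them    *)
(* all; they are listed with their multiplicity as roots of char_poly, and    *)
(* the list is meaningful only up to permutation.                             *)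
Definition spectrum (T : finType) (e : rel T) : seq algC :=
  sval (closed_field_poly_normal (char_poly (adjacency_mx e))).

Definition cospectral (T T' : finType) (e : rel T) (e' : rel T') : Prop :=
  perm_eq (spectrum e) (spectrum e').

Definition connection_set (gT : finGroupType) (S : {set gT}) : Prop :=
  1 \notin S /\ S^-1 = S.

Definition cayley (gT : finGroupType) (S : {set gT}) : rel gT :=
  fun a b => a * b^-1 \in S.

Definition DS (gT : finGroupType) : Prop :=
  forall S : {set gT}, connection_set S ->
  forall (T : finType) (e : rel T), simple_graph e ->
  cospectral (cayley S) e -> graph_iso (cayley S) e.

Definition Cay_DS (gT : finGroupType) : Prop :=
  forall S : {set gT}, connection_set S ->
  forall (hT : finGroupType) (S' : {set hT}), connection_set S' ->
  cospectral (cayley S) (cayley S') -> graph_iso (cayley S) (cayley S').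

Definition C2xQ8 : finGroupType := ('Z_2 * 'Q_8)%type.

Lemma char_poly_spectrum (T : finType) (e : rel T) :
  char_poly (adjacency_mx e) = (\prod_(z <- spectrum e) ('X - z%:P))%R.
Proof.
rewrite /spectrum; case: closed_field_poly_normal => r /= {1}->.
by rewrite (monicP (char_poly_monic _)) scale1r.
Qed.

Lemma mem_spectrum (T : finType) (e : rel T) z :
  (z \in spectrum e) = eigenvalue (adjacency_mx e) z.
Proof. by rewrite eigenvalue_root_char char_poly_spectrum root_prod_XsubC. Qed.

Lemma size_spectrum (T : finType) (e : rel T) : size (spectrum e) = #|T|.
Proof.
have:= size_char_poly (adjacency_mx e).
by rewrite char_poly_spectrum size_prod_XsubC => -[].
Qed.

Lemma cayley_simple (gT : finGroupType) (S : {set gT}) :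
  connection_set S -> simple_graph (cayley S).
Proof.
case=> S1 SV; split=> [a b|a]; rewrite /cayley; last by rewrite mulgV (negPf S1).
by rewrite -{1}SV mem_invg invMg invgK.
Qed.

Lemma Grp_C2xQ8 :
  [set: C2xQ8] \isog Grp (a : b : c :
    c ^+ 2 = 1, a ^+ 2 = b ^+ 2 = b ^- 2, a^-1 * b * a = b^-1,
    a * c = c * a, b * c = c * b).
Proof.
have GrpQ : 'Q_8 \isog Grp (x : y : x ^+ 4, y ^+ 2 = x ^+ 2, x ^ y = x^-1).
  exact: (@Grp_quaternion 3).
have intro_hom (rT : finGroupType) (B : {set rT}) a b c :
    <[a]> <*> <[b]> <*> <[c]> = B -> c ^+ 2 = 1 -> a ^+ 2 = b ^- 2 ->
    b ^+ 2 = b ^- 2 -> a^-1 * b * a = b^-1 -> a * c = c * a -> b * c = c * b ->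
  B \homg Grp (a : b : c :
    c ^+ 2 = 1, a ^+ 2 = b ^+ 2 = b ^- 2, a^-1 * b * a = b^-1,
    a * c = c * a, b * c = c * b).
- move=> defB c2 ab2 bb ba ac bc; apply/existsP; exists (a, b, c) => /=.
  by rewrite !xpair_eqE defB c2 ab2 ba bc ac !eqxx -bb !eqxx.
apply: (@intro_isoGrp _ [set: C2xQ8]%G).
  have /existsP[[x y] /eqP[defQ x4 y2 xy]] := isoGrp_hom GrpQ.
  have Z2 : (Zp1 : 'Z_2) ^+ 2 = 1 by apply/val_inj.
  pose i1 := [morphism of @pairg1 'I_2 (quaternion_gtype 8)].
  pose i2 := [morphism of @pair1g 'I_2 (quaternion_gtype 8)].
  have defG : <[i2 y]> <*> <[i2 x]> <*> <[i1 Zp1]> = [set: C2xQ8].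
    apply/eqP; rewrite eqEsubset subsetT /=; apply/subsetP=> -[z q] _.
    have -> : (z, q) = i2 q * i1 z by congr (_, _); rewrite ?mul1g ?mulg1.
    apply: groupM.
      have: i2 q \in i2 @* (<[x]> <*> <[y]>).
        by rewrite mem_morphim ?inE // defQ inE.
      rewrite morphimY ?subsetT // !morphim_cycle ?inE //.
      by apply: (subsetP _); rewrite joingC joing_subl.
    have: i1 z \in i1 @* <[Zp1]> by rewrite mem_morphim ?inE -?Zp_cycle ?inE.
    by rewrite morphim_cycle ?inE //; apply: (subsetP _); rewrite joing_subr.
  have x2V : x ^- 2 = x ^+ 2 by apply/eqP; rewrite eq_invg_mul -expgD x4.
  have c2 : i1 Zp1 ^+ 2 = 1 by rewrite -morphX ?inE // Z2 morph1.
  have ab2 : i2 y ^+ 2 = i2 x ^- 2.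
    by rewrite -!morphX ?inE // -morphV ?inE // y2 x2V.
  have bb : i2 x ^+ 2 = i2 x ^- 2.
    by rewrite -!morphX ?inE // -morphV ?inE // x2V.
  have ba : (i2 y)^-1 * i2 x * i2 y = (i2 x)^-1.
    by rewrite -mulgA -conjgE -morphJ ?inE // xy morphV ?inE.
  have i12 q : i2 q * i1 Zp1 = i1 Zp1 * i2 q.
    by congr (_, _); rewrite ?mul1g ?mulg1.
  apply: (intro_hom _ _ (i2 y) (i2 x) (i1 Zp1)) => //; exact: i12.
move=> hT H /existsP[[[a b] c] /eqP[defH c2 ab2 bb ba ac bc]].
have homK : (<[b]> <*> <[a]>)%G \homg 'Q_8.
  rewrite GrpQ; apply/existsP; exists (b, a) => /=; rewrite !xpair_eqE eqxx /=.
  rewrite conjgE mulgA ba ab2 -bb !eqxx !andbT.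
  by rewrite (expgD b 2 2) {1}bb mulVg.
have homC : <[c]>%G \homg [set: 'I_2].
  have oc : #[c] %| #[Zp1 : 'I_2] by rewrite order_Zp1 order_dvdn c2.
  by rewrite Zp_cycle; apply/homgP; exists (eltm_morphism oc); rewrite im_eltm.
have [f fE] := homgP homK; have [g gE] := homgP homC.
have cfg q z : commute (f q) (g z).
  apply: (centsP (A := <[b]> <*> <[a]>) (B := <[c]>)).
  - rewrite join_subG !cycle_subG /= cent_cycle.
    by apply/andP; split; apply/cent1P; [exact: bc | exact: ac].
  - by rewrite -fE mem_morphim ?inE.
  - by rewrite -gE mem_morphim ?inE.
pose h (u : C2xQ8) := g u.1 * f u.2.
have hM : {in [set: C2xQ8] &, {morph h : u v / u * v}}.
  move=> u v _ _; rewrite /h !morphM ?inE //.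
  by rewrite -!mulgA; congr (_ * _); rewrite !mulgA; congr (_ * _); exact/esym/cfg.
apply/homgP; exists (Morphism hM); rewrite morphimEdom /=.
have sH : (<[b]> <*> <[a]>) * <[c]> = H.
  rewrite -norm_joinEl; first by rewrite /= -defH (joingC <[a]>).
  by apply: cents_norm; rewrite -fE -gE; apply/centsP=> _ /morphimP[q _ _ ->]
    _ /morphimP[z _ _ ->].
rewrite -{}sH -fE -gE; apply/setP=> w; apply/imsetP/mulsgP.
  case=> -[z q] _ ->; exists (f q) (g z); rewrite ?mem_morphim ?inE //.
  by rewrite /h /= cfg.
case=> _ _ /morphimP[q _ _ ->] /morphimP[z _ _ ->] ->.
by exists (z, q); rewrite ?inE // /h /= cfg.
Qed.

(* Main.v *)
Require Import Defs.
From mathcomp Require Import all_boot all_fingroup all_solvable.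
From mathcomp Require Import all_order all_algebra all_field ring.
From Stdlib Require BinNat Nnat.

(* Cospectrality means equality of the traces of all powers of the adjacency
   matrices, that is, of the numbers of closed walks.

   (1) A graph cospectral to a k-regular graph is k-regular, since the all-ones
   vector then attains the largest eigenvalue k.  Up to complement, the regular
   graphs with 2, 4 or 8 vertices have degree at most 3, and an enumeration shows
   that closed walks tell them apart.

   (2) A group of order 2^(k+1) is determined by a subgroup of index 2, the
   conjugation by an outer element g and the square of g, which gives the 14
   groups of order 16.  Twelve of them carry a Cayley graph with a nonisomorphic
   cospectral mate: the 4 x 4 rook graph, whose mate is the Shrikhande graph on
   C4 x C4, or a graph of degree 7 with a mate on C8 x C2.  For the other two,
   every Cayley graph is compared with all Cayley graphs on 16 vertices of degree
   at most 7 (up to group automorphisms); equal closed walks always come with an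
   isomorphism.

   (3) A pair as in (2) for a subgroup of G gives one for G, by taking the product
   of the mate with a cyclic group.  A group of order 32 contains one of the twelve
   groups or is extraspecial of type 2^(1+4)_-; the latter has an elementary
   abelian quotient of order 16, in which the rook graph is pulled back. *)

Set Implicit Arguments.
Unset Strict Implicit.
Unset Printing Implicit Defensive.

Import GroupScope.

(** * Spectra, closed walks and regularity *)

Section LinearAlgebra.

Import Order.TTheory GRing.Theory Num.Theory.
Local Open Scope ring_scope.
Local Open Scope sesquilinear_scope.

(** Eigenvalues are unfit for computation, numbers of closed walks are not, so the finite claims
    become boolean tests on lists. They are used in two ways. To prove graphs isomorphic, a few
    closed walk counts are compared: agreement is only necessary for cospectrality, but already
    forces an isomorphism. To prove cospectrality, all lengths are needed, and a polynomial equation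
    satisfied by the matrix reduces them to finitely many; the copies of [K4] then exclude an
    isomorphism.

    The size of the enumerations is the obstacle. Graphs are bit strings built bit by bit, and a
    prefix is dropped once some symmetry makes it lexicographically larger; any set of symmetries is
    sound, since a largest string in the orbit survives. For Cayley graphs, the closed walks at the
    identity replace the trace.

    A multiplication table may describe a proper subgroup: walks and cliques at the identity stay in
    a subgroup that contains the connection set. So a pair found in a subgroup serves for a large
    group without any computation there. *)

Lemma perm_eq_power_sums (F : numClosedFieldType) (r r' : seq F) :
  (forall j, \sum_(z <- r) z ^+ j = \sum_(z <- r') z ^+ j) -> perm_eq r r'.
Proof.
move=> eq_sum.
have eq_horner (p : {poly F}) : \sum_(z <- r) p.[z] = \sum_(z <- r') p.[z].
  have horner_sum (t : seq F) : \sum_(z <- t) p.[z] =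
      \sum_(i < size p) p`_i * \sum_(z <- t) z ^+ i.
    rewrite (eq_bigr (fun z => \sum_(i < size p) p`_i * z ^+ i)); last first.
      by move=> z _; rewrite horner_coef.
    by rewrite exchange_big; apply: eq_bigr => i _; rewrite mulr_sumr.
  by rewrite !horner_sum; apply: eq_bigr => i _; rewrite eq_sum.
apply/allP=> z _ /=; apply/eqP.
(* [p] vanishes at every listed value except [z], so its sum over a list is [p.[z]] times the
   multiplicity of [z]. *)
pose s := [seq w <- undup (r ++ r') | w != z].
pose p := \prod_(w <- s) ('X - w%:P).
have pz : p.[z] != 0.
  rewrite horner_prod prodf_seq_neq0; apply/allP=> w.
  by rewrite mem_filter => /andP[wz _]; rewrite !hornerE subr_eq0 eq_sym.
have count_horner (t : seq F) : {subset t <= r ++ r'} ->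
    \sum_(w <- t) p.[w] = p.[z] *+ count_mem z t.
  elim: t => [|w t IHt] st; first by rewrite big_nil.
  rewrite big_cons IHt => [|x xt]; last by rewrite st // inE xt orbT.
  rewrite /= mulrnDr; congr (_ + _); have [->|wz] := eqVneq w z => //=.
  rewrite mulr0n horner_prod; apply/eqP; rewrite prodf_seq_eq0.
  apply/hasP; exists w; last by rewrite !hornerE subrr.
  by rewrite mem_filter wz mem_undup st ?mem_head.
have := eq_horner p; rewrite !count_horner => [/eqP|x|x]; last 2 first.
- by rewrite mem_cat orbC => ->.
- by rewrite mem_cat => ->.
by move/eqP/(mulrIn pz).
Qed.

Lemma similar_exp (F : fieldType) n (P A D : 'M[F]_n) j : P \in unitmx ->
  A = invmx P *m D *m P -> A ^+ j = invmx P *m D ^+ j *m P.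
Proof.
move=> Pu ->; elim: j => [|j IHj]; first by rewrite !expr0 mulmx1 mulVmx.
rewrite !exprS IHj.
by rewrite -!mulmxE !mulmxA mulmxK.
Qed.

Lemma diag_mx_exp (F : fieldType) n (d : 'rV[F]_n) j :
  diag_mx d ^+ j = diag_mx (\row_i d 0 i ^+ j).
Proof.
elim: j => [|j IHj].
  by rewrite expr0; apply/matrixP=> i k; rewrite !mxE.
rewrite exprS IHj -mulmxE mulmx_diag; congr diag_mx.
by apply/rowP=> i; rewrite !mxE exprS.
Qed.

Lemma char_poly_similar (F : fieldType) n (P A D : 'M[F]_n) :
  P \in unitmx -> A = invmx P *m D *m P -> char_poly A = char_poly D.
Proof.
move=> Pu ->; rewrite /char_poly /char_poly_mx.
have mP (B C : 'M[F]_n) : map_mx polyC (B *m C) =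
   map_mx polyC B *m map_mx polyC C by rewrite map_mxM.
have -> : 'X%:M - map_mx polyC (invmx P *m D *m P) =
    map_mx polyC (invmx P) *m ('X%:M - map_mx polyC D) *m map_mx polyC P.
  rewrite mulmxBr mulmxBl !mP; congr (_ - _).
  by rewrite -mulmxA -scalar_mxC mulmxA -mP mulVmx // map_mx1 mul1mx.
by rewrite !det_mulmx mulrC mulrA -det_mulmx -mP mulmxV // map_mx1 det1 mul1r.
Qed.

Section Adjacency.

Variables (T : finType) (e : rel T).
Hypothesis e_sym : symmetric e.

Let A := adjacency_mx e.

Lemma adjacency_hermsym : A \is hermsymmx.
Proof.
apply: realsym_hermsym.
  apply/is_hermitianmxP; rewrite expr0 scale1r; apply/matrixP=> i j.
  by rewrite !mxE e_sym.
by apply/mxOverP=> i j; rewrite mxE realn.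
Qed.

Lemma adjacency_spectral :
  A = invmx (spectralmx A) *m diag_mx (spectral_diag A) *m spectralmx A.
Proof. exact/orthomx_spectralP/hermitian_normalmx/adjacency_hermsym. Qed.

Lemma perm_spectrum :
  perm_eq (spectrum e) [seq spectral_diag A 0 i | i : 'I_#|T|].
Proof.
apply: prod_XsubC_eq; rewrite -char_poly_spectrum.
rewrite (char_poly_similar (spectral_unit _) adjacency_spectral).
rewrite char_poly_trig; last exact/diag_mx_is_trig.
by rewrite big_map big_enum /=; apply: eq_bigr => i _; rewrite mxE eqxx mulr1n.
Qed.

Lemma trace_adjacency_exp j : \tr (A ^+ j) = \sum_(z <- spectrum e) z ^+ j.
Proof.
rewrite (perm_big _ perm_spectrum) /= big_map big_enum /=.
rewrite (similar_exp _ (spectral_unit _) adjacency_spectral) diag_mx_exp.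
rewrite mxtrace_mulC mulmxA mulmxV ?spectral_unit // mul1mx.
by rewrite mxtrace_diag; apply: eq_bigr => i _; rewrite mxE.
Qed.

End Adjacency.

Lemma cospectral_trace (T T' : finType) (e : rel T) (e' : rel T') :
  symmetric e -> symmetric e' ->
  cospectral e e' <->
  forall j, \tr (adjacency_mx e ^+ j) = \tr (adjacency_mx e' ^+ j).
Proof.
move=> es es'; split=> [cos j|trE].
  by rewrite !trace_adjacency_exp //; apply: perm_big.
apply: perm_eq_power_sums => j.
by rewrite -!trace_adjacency_exp.
Qed.

Definition regular (T : finType) (e : rel T) (k : nat) :=
  forall x, #|e x| = k.

Lemma sum_adjacency_row (T : finType) (e : rel T) i :
  \sum_j adjacency_mx e i j = #|e (enum_val i)|%:R.
Proof.
rewrite -sum1_card natr_sum [RHS]big_mkcond [RHS](reindex _ (onW_bij _ (enum_val_bij T))) /=.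
by apply: eq_bigr => j _; rewrite mxE -topredE /=; case: (e _ _).
Qed.

Lemma trace_adjacency_sqr (T : finType) (e : rel T) : symmetric e ->
  \tr (adjacency_mx e ^+ 2) = \sum_(x : T) #|e x|%:R.
Proof.
move=> es; rewrite /mxtrace [RHS](reindex _ (onW_bij _ (enum_val_bij T))) /=.
apply: eq_bigr => i _; rewrite -sum_adjacency_row expr2 -mulmxE mxE.
by apply: eq_bigr => j _; rewrite !mxE es; case: (e _ _); rewrite ?mulr1 ?mulr0.
Qed.


(* The quadratic form \sum_(i, j) A i j |v_i - v_j|^2 is nonnegative. *)
Lemma eigenvalue_regular (T : finType) (e : rel T) k z : regular e k ->
  symmetric e -> eigenvalue (adjacency_mx e) z -> z <= k%:R.
Proof.
move=> ek es /eigenvalueP[v vA v0]; set A := adjacency_mx e in vA.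
pose N := \sum_i `|v 0 i| ^+ 2.
have N_gt0 : 0 < N.
  rewrite lt_def sumr_ge0 ?andbT => [|i _]; last by rewrite exprn_ge0.
  apply: contraNneq v0 => /eqP.
  rewrite psumr_eq0 => [/allP vi0|i _]; last by rewrite exprn_ge0.
  apply/eqP/rowP=> i; rewrite mxE.
  by have := vi0 i (mem_index_enum _); rewrite /= sqrf_eq0 normr_eq0 => /eqP.
have AT i j : A i j = A j i by rewrite !mxE es.
have vAj j : \sum_i v 0 i * A i j = z * v 0 j.
  by have /rowP/(_ j) := vA; rewrite !mxE.
have rowA i : \sum_j A i j = k%:R by rewrite sum_adjacency_row ek.
have sumE : \sum_i \sum_j A i j * `|v 0 i - v 0 j| ^+ 2 = 2%:R * (k%:R - z) * N.
  transitivity (\sum_i \sum_j (A i j * `|v 0 i| ^+ 2 + A j i * `|v 0 j| ^+ 2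
     - v 0 i * A i j * (v 0 j)^* - v 0 j * A j i * (v 0 i)^*)).
    apply: eq_bigr => i _; apply: eq_bigr => j _.
    by rewrite !normCK rmorphB /= (AT j i); ring.
  pose S := \sum_i \sum_j A i j * `|v 0 i| ^+ 2.
  have SE : S = k%:R * N.
    by rewrite /S mulr_sumr; apply: eq_bigr => i _; rewrite -mulr_suml rowA.
  pose U := \sum_i \sum_j v 0 i * A i j * (v 0 j)^*.
  have UE : U = z * N.
    rewrite /U exchange_big mulr_sumr; apply: eq_bigr => j _ /=.
    by rewrite -mulr_suml vAj normCK mulrA.
  transitivity (S + S - U - U).
    have S' : S = \sum_i \sum_j A j i * `|v 0 j| ^+ 2 by rewrite /S exchange_big.
    have U' : U = \sum_i \sum_j v 0 j * A j i * (v 0 i)^* by rewrite /U exchange_big.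
    rewrite {2}S' {2}U' /S /U -!sumrN -!big_split; apply: eq_bigr => i _ /=.
    by rewrite -!sumrN -!big_split.
  by rewrite SE UE; ring.
have : 0 <= 2%:R * (k%:R - z) * N.
  rewrite -sumE; apply: sumr_ge0 => i _; apply: sumr_ge0 => j _.
  by rewrite mxE mulr_ge0 ?ler0n // exprn_ge0.
by rewrite pmulr_lge0 // pmulr_rge0 ?ltr0n // subr_ge0.
Qed.

(** The order and the trace of the square give [e'] the mean degree [k], which is the Rayleigh
    quotient of the all-ones vector. As no eigenvalue exceeds [k], this vector is an eigenvector for
    [k], and the eigenvector equation reads off the degrees. *)
Lemma cospectral_regular (T T' : finType) (e : rel T) (e' : rel T') k :
  symmetric e -> symmetric e' -> regular e k -> cospectral e e' ->
  regular e' k.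
Proof.
move=> es es' ek cos.
have trE := (cospectral_trace es es').1 cos.
set A := adjacency_mx e'; set P := spectralmx A; set D := spectral_diag A.
have AE : A = P ^t* *m diag_mx D *m P.
  by rewrite -invmx_unitary ?spectral_unitarymx // -adjacency_spectral.
have D_le i : D 0 i <= k%:R.
  apply: (eigenvalue_regular ek es); rewrite -mem_spectrum (perm_mem cos).
  by rewrite (perm_mem (perm_spectrum es')); apply: image_f.
pose u : 'rV[algC]_#|T'| := const_mx 1.
have [w uE] : exists w, w *m P = u.
  exists (u *m P ^t*).
  by rewrite -mulmxA -invmx_unitary ?spectral_unitarymx // mulVmx ?mulmx1
             ?spectral_unit.
have norm_w : \sum_i w 0 i * (w 0 i)^* = \sum_(i < #|T'|) (1 : algC).
  transitivity ((w *m w ^t*) 0 0).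
    by rewrite mxE; apply: eq_bigr => i _; rewrite !mxE.
  transitivity ((u *m u ^t*) 0 0); last first.
    by rewrite mxE; apply: eq_bigr => i _; rewrite !mxE rmorph1 mulr1.
  by rewrite -uE trmx_mul map_mxM mulmxA mulmxtVK ?spectral_unitarymx.
have norm_uA : \sum_i D 0 i * (w 0 i * (w 0 i)^*) =
    \sum_i \sum_j A i j.
  transitivity ((u *m A *m u ^t*) 0 0).
    rewrite AE -uE trmx_mul map_mxM !mulmxA.
    rewrite !mulmxtVK ?spectral_unitarymx //.
    rewrite mxE; apply: eq_bigr => i _; rewrite mul_mx_diag !mxE.
    by rewrite mulrCA mulrA.
  rewrite exchange_big mxE; apply: eq_bigr => j _.
  by rewrite !mxE rmorph1 mulr1; apply: eq_bigr => i _; rewrite mxE mul1r.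
have cardTT' : #|T| = #|T'|.
  by rewrite -(size_spectrum e) -(size_spectrum e') (perm_size cos).
have sum_deg : \sum_i \sum_j A i j = \sum_(i < #|T'|) k%:R.
  transitivity (\sum_(x : T') #|e' x|%:R : algC).
    rewrite [RHS](reindex _ (onW_bij _ (enum_val_bij T'))) /=.
    by apply: eq_bigr => i _; rewrite sum_adjacency_row.
  rewrite -trace_adjacency_sqr // -trE trace_adjacency_sqr //.
  under eq_bigr do rewrite ek.
  by rewrite !sumr_const card_ord cardTT'.
(* The terms are nonnegative, so each of them vanishes: [w] has nonzero coordinates only at the
   eigenvalue [k]. *)
have wD0 : \sum_i (k%:R - D 0 i) * (w 0 i * (w 0 i)^*) = 0.
  under eq_bigr do rewrite mulrBl.
  rewrite sumrB -mulr_sumr norm_w norm_uA sum_deg mulr_sumr.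
  by rewrite -sumrB big1 // => i _; rewrite mulr1 subrr.
have wD i : w 0 i * D 0 i = k%:R * w 0 i.
  have /eqP := wD0; rewrite psumr_eq0 => [/allP/(_ i (mem_index_enum _))|j _].
    rewrite /= mulf_eq0 subr_eq0 -normCK sqrf_eq0 normr_eq0.
    by case/orP=> /eqP => [<-|->]; rewrite ?mul0r ?mulr0 // mulrC.
  by rewrite mulr_ge0 ?subr_ge0 // -normCK exprn_ge0.
have uA : u *m A = k%:R *: u.
  rewrite AE -uE !mulmxA mulmxtVK ?spectral_unitarymx // scalemxAl; congr (_ *m _).
  by apply/rowP=> i; rewrite mul_mx_diag !mxE wD.
move=> x; apply/eqP; rewrite -(eqr_nat algC) -(enum_rankK x) -sum_adjacency_row.
have /rowP/(_ (enum_rank x)) := uA; rewrite !mxE mulr1 => <-; apply/eqP.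
by apply: eq_bigr => j _; rewrite !mxE mul1r es'.
Qed.

(** * Complements of regular graphs *)

Definition graph_compl (T : finType) (e : rel T) : rel T :=
  fun x y => (x != y) && ~~ e x y.

Lemma graph_compl_sym (T : finType) (e : rel T) :
  symmetric e -> symmetric (graph_compl e).
Proof. by move=> es x y; rewrite /graph_compl eq_sym es. Qed.

Lemma graph_compl_regular (T : finType) (e : rel T) k : irreflexive e ->
  regular e k -> regular (graph_compl e) (#|T| - k).-1.
Proof.
move=> ei ek x; have := cardC (e x); rewrite ek => <-.
rewrite addKn [in RHS](cardD1 x).
have -> : x \in [predC e x] by rewrite !inE -topredE /= ei.
by apply: eq_card => y; rewrite !inE /graph_compl -!topredE /= eq_sym.
Qed.

Lemma graph_iso_compl (T T' : finType) (e : rel T) (e' : rel T') :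
  irreflexive e -> irreflexive e' ->
  graph_iso (graph_compl e) (graph_compl e') -> graph_iso e e'.
Proof.
move=> ei ei' [f bf fE]; exists f => // x y.
have := fE x y; rewrite /graph_compl (bij_eq bf).
by have [->|_] /= := eqVneq x y; rewrite ?ei ?ei' // => /negb_inj.
Qed.

Lemma adjacency_compl (T : finType) (e : rel T) : irreflexive e ->
  adjacency_mx (graph_compl e) = const_mx 1 - (1%:M + adjacency_mx e).
Proof.
move=> ei; apply/matrixP=> i j; rewrite !mxE /graph_compl.
rewrite (inj_eq enum_val_inj); case: eqVneq => [->|_] /=.
  by rewrite ei addr0 subrr.
by rewrite add0r; case: (e _ _); rewrite ?subrr ?subr0.
Qed.

(* The scalar c depends only on n, b and j. *)
Lemma expr_const_mx_add n (B B' : 'M[algC]_n) b j :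
  let J := const_mx 1 in
  J *m B = b *: J -> B *m J = b *: J -> J *m B' = b *: J -> B' *m J = b *: J ->
  exists c : algC,
    (J + B) ^+ j = B ^+ j + c *: J /\ (J + B') ^+ j = B' ^+ j + c *: J.
Proof.
move=> J JB BJ JB' BJ'.
have JJ : J *m J = n%:R *: J.
  apply/matrixP=> i k; rewrite !mxE (eq_bigr (fun=> 1)) ?sumr_const ?card_ord.
    by rewrite mulr1.
  by move=> l _; rewrite !mxE mulr1.
suff aux (C : 'M_n) (c : algC) m : J *m C = b *: J -> C *m J = b *: J ->
    (J + C) ^+ m = C ^+ m + c *: J ->
    (J + C) ^+ m.+1 = C ^+ m.+1 + (b ^+ m + c * (n%:R + b)) *: J.
  elim: j => [|j [c [cE cE']]]; first by exists 0; rewrite !scale0r !addr0.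
  by exists (b ^+ j + c * (n%:R + b)); split; apply: aux.
move=> JC CJ IHm; rewrite exprS IHm mulrDl !mulrDr -!mulmxE -!scalemxAr JJ CJ.
have -> : J *m C ^+ m = b ^+ m *: J.
  elim: m {IHm} => [|m IHm]; first by rewrite !expr0 scale1r mulmx1.
  by rewrite !exprS -mulmxE mulmxA JC -scalemxAl IHm scalerA.
have -> : C *m C ^+ m = C ^+ m.+1 by rewrite exprS.
by rewrite !scalerA !scalerDl addrCA -!addrA.
Qed.

(** The complement has matrix [J - (1 + A)]. By regularity [J] absorbs [1 + A] with the same factor
    for both graphs, so the powers are those of [- (1 + A)] plus a common multiple of [J]; the
    binomial formula then expresses their traces by those of the powers of [A]. *)
Lemma cospectral_compl (T T' : finType) (e : rel T) (e' : rel T') k :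
  simple_graph e -> simple_graph e' -> regular e k -> regular e' k ->
  cospectral e e' -> cospectral (graph_compl e) (graph_compl e').
Proof.
move=> [es ei] [es' ei'] ek ek' cos.
have trE := (cospectral_trace es es').1 cos.
have eqT : #|T'| = #|T|.
  by rewrite -(size_spectrum e) -(size_spectrum e') (perm_size cos).
apply/(cospectral_trace (graph_compl_sym es) (graph_compl_sym es')) => j.
rewrite !adjacency_compl //.
have regJ (T0 : finType) (f : rel T0) : symmetric f -> regular f k ->
    let B := - (1%:M + adjacency_mx f) in
    const_mx 1 *m B = - (1 + k%:R) *: const_mx 1 :> 'M_#|T0| /\
    B *m const_mx 1 = - (1 + k%:R) *: const_mx 1 :> 'M_#|T0|.
  move=> fs fk; split; apply/matrixP=> i l; rewrite !mxE.
    transitivity (- \sum_m (1%:M l m + adjacency_mx f l m)).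
      rewrite -sumrN; apply: eq_bigr => m _; rewrite !mxE mul1r fs.
      by rewrite (eq_sym m).
    rewrite big_split /= sum_adjacency_row fk (bigD1 l) //= big1 => [|m ml].
      by rewrite mxE eqxx addr0 mulr1.
    by rewrite mxE eq_sym (negPf ml).
  transitivity (- \sum_m (1%:M i m + adjacency_mx f i m)).
    by rewrite -sumrN; apply: eq_bigr => m _; rewrite !mxE mulr1.
  rewrite big_split /= sum_adjacency_row fk (bigD1 i) //= big1 => [|m ml].
    by rewrite mxE eqxx addr0 mulr1.
  by rewrite mxE eq_sym (negPf ml).
have := regJ _ _ es ek; have := regJ _ _ es' ek'.
move: (adjacency_mx e) (adjacency_mx e') trE.
move: #|T'| eqT => _ -> A A' trE [JA' AJ'] [JA AJ].
have [c [-> ->]] := expr_const_mx_add j JA AJ JA' AJ'.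
rewrite !mxtraceD; congr (_ + _).
rewrite -[- (_ + A)]mulN1r -[- (_ + A')]mulN1r.
rewrite !exprMn_comm; try exact/commr_sym/commrN1.
rewrite -[1%:M]/(1 : 'M_#|T|) -signr_odd.
have -> : \tr ((-1) ^+ odd j * (1 + A) ^+ j) = (-1) ^+ odd j * \tr ((1 + A) ^+ j).
  by case: (odd j); rewrite ?expr1 ?mulN1r ?expr0 ?mul1r ?raddfN.
have -> : \tr ((-1) ^+ odd j * (1 + A') ^+ j) = (-1) ^+ odd j * \tr ((1 + A') ^+ j).
  by case: (odd j); rewrite ?expr1 ?mulN1r ?expr0 ?mul1r ?raddfN.
congr (_ * _); rewrite ![1 + _]addrC !exprD1n !raddf_sum /=.
by apply: eq_bigr => i _; rewrite !raddfMn /= trE.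
Qed.

End LinearAlgebra.

(** * Computing with adjacency rows *)

(* Unlike [all], [has] and [&&], these stop early under call-by-value too. *)
Fixpoint lall (T : Type) (a : T -> bool) (s : seq T) :=
  if s is x :: s' then if a x then lall a s' else false else true.

Fixpoint lhas (T : Type) (a : T -> bool) (s : seq T) :=
  if s is x :: s' then if a x then true else lhas a s' else false.

Lemma lallE (T : Type) (a : T -> bool) s : lall a s = all a s.
Proof. by elim: s => //= x s ->. Qed.

Lemma lhasE (T : Type) (a : T -> bool) s : lhas a s = has a s.
Proof. by elim: s => //= x s ->. Qed.

Definition nmem (x : nat) := lhas (eqn x).

Lemma nmemE x s : nmem x s = (x \in s).
Proof. by rewrite /nmem lhasE -has_pred1; apply: eq_has => y /=; rewrite eq_sym. Qed.

Section Walks.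

Local Notation N := BinNat.N.t.
Local Notation to_nat := BinNat.N.to_nat.

(** Walk counts are kept in binary, as they grow exponentially with the length. *)
Fixpoint dot (r : seq bool) (v : seq N) : N :=
  match r, v with
  | b :: r', x :: v' => if b then BinNat.N.add x (dot r' v') else dot r' v'
  | _, _ => BinNat.N.zero
  end.

Definition step (M : seq (seq bool)) (v : seq N) := map (fun r => dot r v) M.

Definition unitv n i : seq N :=
  map (fun j => if eqn i j then BinNat.N.one else BinNat.N.zero) (iota 0 n).

(** With [v] the unit vector at [i], these are the closed walks at [i] of lengths 1 to [l]; length 0
    is left out. *)
Fixpoint walks (M : seq (seq bool)) i (v : seq N) l : seq N :=
  if l is l'.+1 then
    let v' := step M v in nth BinNat.N.zero v' i :: walks M i v' l'
  else [::].

Fixpoint nwalks (T : finType) (e : rel T) j (x y : T) : nat :=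
  if j is j'.+1 then \sum_(z | e x z) nwalks e j' z y else x == y.

Lemma trace_nwalks (T : finType) (e : rel T) j :
  (\tr (adjacency_mx e ^+ j) = (\sum_x nwalks e j x x)%:R)%R.
Proof.
have expE i k : ((adjacency_mx e ^+ j) i k =
    (nwalks e j (enum_val i) (enum_val k))%:R)%R.
  elim: j i => [|j IHj] i /=.
    by rewrite GRing.expr0 mxE (inj_eq enum_val_inj).
  rewrite GRing.exprS -mulmxE mxE [in RHS]big_mkcond GRing.natr_sum.
  rewrite [RHS](reindex _ (onW_bij _ (enum_val_bij T))) /=.
  apply: eq_bigr => l _; rewrite IHj mxE.
  by case: (e _ _); rewrite ?GRing.mul1r ?GRing.mul0r.
rewrite /mxtrace GRing.natr_sum [RHS](reindex _ (onW_bij _ (enum_val_bij T))) /=.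
by apply: eq_bigr => i _; rewrite expE.
Qed.

Lemma cospectral_nwalks (T T' : finType) (e : rel T) (e' : rel T') :
  symmetric e -> symmetric e' ->
  cospectral e e' <->
  forall j, \sum_x nwalks e j x x = \sum_x nwalks e' j x x.
Proof.
move=> es es'; rewrite cospectral_trace //.
split=> trE j; last by rewrite !trace_nwalks trE.
by apply/eqP; rewrite -(Num.Theory.eqr_nat algC) -!trace_nwalks trE.
Qed.

Definition adj_rows (T : finType) (e : rel T) (s : seq T) :=
  [seq [seq e x y | y <- s] | x <- s].

Lemma nth_adj_rows (T : finType) (e : rel T) x0 s i j : i < size s -> j < size s ->
  nth false (nth [::] (adj_rows e s) i) j = e (nth x0 s i) (nth x0 s j).
Proof. by move=> ltis ltjs; rewrite (nth_map x0) // (nth_map x0). Qed.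

Lemma dot_spec (T : finType) (a : pred T) (f : T -> nat) s v :
  map to_nat v = map f s -> to_nat (dot (map a s) v) = \sum_(x <- s | a x) f x.
Proof.
elim: s v => [|x s IHs] [|n v] //=; first by rewrite big_nil.
case=> nE /IHs vE; rewrite big_cons; case: (a x) => //.
by rewrite Nnat.N2Nat.inj_add nE vE.
Qed.

(** [s] need not list all vertices: a union of connected components is enough to count the walks
    inside it. This lets a subgroup stand for the group around it. *)
Definition enclosed (T : finType) (e : rel T) (s : seq T) :=
  uniq s /\ forall x y, x \in s -> e x y -> y \in s.

Lemma step_spec (T : finType) (e : rel T) s j y v : enclosed e s ->
  map to_nat v = [seq nwalks e j x y | x <- s] ->
  map to_nat (step (adj_rows e s) v) = [seq nwalks e j.+1 x y | x <- s].
Proof.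
move=> [s_uniq s_closed] vE; rewrite /step /adj_rows -!map_comp.
apply/eq_in_map=> x xs /=; rewrite (dot_spec _ vE) big_mkcond big_uniq //=.
rewrite [LHS]big_mkcond [RHS]big_mkcond; apply: eq_bigr => z _.
by case exz: (e x z); rewrite ?if_same // (s_closed x).
Qed.

Lemma unitv_spec (T : finType) (e : rel T) x0 s i : uniq s -> i < size s ->
  map to_nat (unitv (size s) i) = [seq nwalks e 0 x (nth x0 s i) | x <- s].
Proof.
move=> s_uniq lti; set y := nth x0 s i.
rewrite /unitv -map_comp -[in RHS](mkseq_nth x0 s) -map_comp.
apply/eq_in_map=> j; rewrite mem_iota /= => ltj.
by rewrite /= /y nth_uniq // eqnE eq_sym; case: eqP.
Qed.

Lemma walks_spec (T : finType) (e : rel T) x0 s i l : enclosed e s ->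
  i < size s ->
  map to_nat (walks (adj_rows e s) i (unitv (size s) i) l) =
  [seq nwalks e j (nth x0 s i) (nth x0 s i) | j <- iota 1 l].
Proof.
move=> es lti; have := unitv_spec e x0 es.1 lti.
elim: l (unitv _ _) 0 => //= l IHl v j vE.
have v'E := step_spec es vE; rewrite (IHl _ _ v'E); congr (_ :: _).
have := congr1 (nth 0 ^~ i) v'E; rewrite (nth_map x0) //= => <-.
by rewrite (nth_map BinNat.N.zero) // size_map size_map.
Qed.

End Walks.

(** * Search for an isomorphism between graphs given by rows *)

Section RowIsomorphism.

Fixpoint agree (r r' : seq bool) (f : seq nat) :=
  match f, r with
  | [::], _ => true
  | j :: f', b :: r1 =>
    if eqb b (nth false r' j) then agree r1 r' f' else false
  | _, _ => false
  end.

(** Backtracking: [f] lists the images of the vertices already treated, and a new image only has to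
    agree with these. *)
Fixpoint iso_search (M : seq (seq bool)) (M' : seq (nat * seq bool)) f :=
  if M is r :: M1 then
    lhas (fun vr => if nmem vr.1 f then false
                    else if agree r vr.2 f then iso_search M1 M' (rcons f vr.1)
                    else false) M'
  else true.

Definition numbered (M : seq (seq bool)) := zip (iota 0 (size M)) M.

(** Only entries below the diagonal are compared; symmetry and irreflexivity give the others. *)
Definition rows_iso (M M' : seq (seq bool)) :=
  exists g : seq nat,
    [/\ size g = size M, uniq g, all (gtn (size M')) g
      & forall i j, i < size M -> j < i -> nth false (nth [::] M i) j =
          nth false (nth [::] M' (nth 0 g i)) (nth 0 g j)].

Lemma agreeP r r' f : agree r r' f ->
  forall j, j < size f -> nth false r j = nth false r' (nth 0 f j).
Proof.
elim: f r => //= k f IHf [|b r] //=.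
case: ifP => // /(eqbP b _) bE /IHf rE [|j] /=; [by [] | by rewrite ltnS; apply: rE].
Qed.

Lemma iso_searchP M M' : iso_search M (numbered M') [::] -> rows_iso M M'.
Proof.
suff gen f : uniq f -> all (gtn (size M')) f -> iso_search M (numbered M') f ->
    exists g, [/\ size g = size f + size M, uniq g, all (gtn (size M')) g,
      take (size f) g = f
    & forall i j, i < size M -> j < size f + i -> nth false (nth [::] M i) j =
        nth false (nth [::] M' (nth 0 g (size f + i))) (nth 0 g j)].
  by move/(gen [::] isT isT) => [g [? ? ? _ ?]]; exists g.
elim: M f => [|r M IHM] f f_uniq f_lt /=.
  by exists f; rewrite addn0 take_size.
rewrite lhasE => /hasP[[v r'] /=].
case/(nthP (0, [::])) => k; rewrite size_zip size_iota minnn => ltk.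
rewrite nth_zip ?size_iota // nth_iota // add0n => -[<- <-] {v r'}.
rewrite nmemE; case: ifP => // kf; case: ifP => // /agreeP rE.
case/IHM=> [||g [size_g g_uniq g_lt gE ME]].
- by rewrite rcons_uniq kf.
- by rewrite all_rcons f_lt andbT.
have gfE j : j < size f -> nth 0 g j = nth 0 f j.
  move=> ltj; rewrite -(nth_take (n0 := (size f).+1)) ?ltnS 1?ltnW //.
  by rewrite -(size_rcons f k) gE nth_rcons ltj.
have gkE : nth 0 g (size f) = k.
  rewrite -(nth_take (n0 := (size f).+1)) //.
  by rewrite -(size_rcons f k) gE nth_rcons ltnn eqxx.
exists g; split=> //.
- by rewrite size_g size_rcons addSnnS.
- by rewrite -[g](cat_take_drop (size f).+1) -(size_rcons f k) gE -cats1 -catA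
             take_size_cat.
case=> [|i] j; first by rewrite addn0 => _ ltj; rewrite /= gkE gfE // rE.
rewrite ltnS /= => lti ltj; rewrite ME ?size_rcons //; last by rewrite addSnnS.
by rewrite addSnnS.
Qed.

Lemma graph_iso_rows (T T' : finType) (e : rel T) (e' : rel T') s s'
    (x0' : T') :
  simple_graph e -> simple_graph e' -> uniq s -> (forall x, x \in s) ->
  uniq s' -> (forall x, x \in s') -> size s = size s' ->
  rows_iso (adj_rows e s) (adj_rows e' s') -> graph_iso e e'.
Proof.
move=> [es ei] [es' ei'] s_uniq s_all s'_uniq s'_all ss' [g].
rewrite !size_map => -[size_g g_uniq /allP g_lt gE].
have idx x : index x s < size s by rewrite index_mem.
have g_idx x : nth 0 g (index x s) < size s'.
  by apply: g_lt; rewrite mem_nth ?size_g.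
pose f x := nth x0' s' (nth 0 g (index x s)).
have f_inj : injective f.
  move=> x y /eqP; rewrite nth_uniq // nth_uniq ?size_g //.
  by move=> /eqP /(congr1 (nth x s)); rewrite !nth_index.
have card_all (U : finType) (t : seq U) : uniq t -> (forall x, x \in t) ->
    #|U| = size t.
  by move=> t_uniq t_all; rewrite -(card_uniqP t_uniq); apply: eq_card => x;
     rewrite t_all.
exists f.
  by apply: inj_card_bij => //; rewrite (card_all _ s) // (card_all _ s') // ss'.
have fE x y : index y s < index x s -> e' (f x) (f y) = e x y.
  move=> ltyx; have := gE _ _ (idx x) ltyx.
  by rewrite (nth_adj_rows e x) // (nth_adj_rows e' x0') // !nth_index.
move=> x y; case: (ltngtP (index x s) (index y s)) => [ltxy|ltyx|eqxy].
- by rewrite es es' fE.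
- exact: fE.
have -> : x = y by have := congr1 (nth x s) eqxy; rewrite !nth_index.
by rewrite ei ei'.
Qed.

End RowIsomorphism.

(** * Enumeration of bit strings up to symmetry *)

Section BitStrings.

Fixpoint leaves (bad : seq bool -> bool) n p :=
  if bad p then [::] else
  if n is n'.+1 then leaves bad n' (rcons p true) ++ leaves bad n' (rcons p false)
  else [:: p].

Lemma mem_leaves bad n p q : size q = n ->
  (forall i, ~~ bad (take i (p ++ q))) -> p ++ q \in leaves bad n p.
Proof.
elim: n p q => [|n IHn] p [|b q] //=.
  by move=> _ /(_ (size p)); rewrite cats0 take_size => /negPf->; rewrite mem_head.
move=> [size_q] good; have := good (size p); rewrite take_size_cat // => /negPf->.
have := IHn (rcons p b) q size_q; rewrite cat_rcons => /(_ good).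
by rewrite mem_cat; case: b {good} => ->; rewrite ?orbT.
Qed.

(* Compares [p], a final part of [q], with the reordering of [q] by [s], as far
   as the entries of [q] go. *)
Fixpoint lex_lt (p q : seq bool) (s : seq nat) :=
  match p, s with
  | b :: p', j :: s' =>
    if onth q j is Some c then if eqb b c then lex_lt p' q s' else c
    else false
  | _, _ => false
  end.

Lemma onth_take (T : Type) i (q : seq T) j c :
  onth (take i q) j = Some c -> onth q j = Some c.
Proof. by elim: q i j => [|x q IHq] [|i] [|j] //=; apply: IHq. Qed.

(** Missing entries make [lex_lt] false, so a comparison that holds on prefixes holds on the full
    strings. This is what allows pruning. *)
Lemma lex_lt_take i k p q s : lex_lt (take k p) (take i q) s -> lex_lt p q s.
Proof.
elim: p k s => [|b p IHp] [|k] [|j s] //=.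
case qj: (onth _ j) => [c|] //; rewrite (onth_take qj).
by case: ifP => // _; apply: IHp.
Qed.

Fixpoint bits_val (p : seq bool) :=
  if p is b :: p' then b * 2 ^ size p' + bits_val p' else 0.

Lemma bits_val_lt p : bits_val p < 2 ^ size p.
Proof.
elim: p => //= b p IHp; rewrite expnS mul2n -addnn.
by case: b; rewrite ?mul1n ?mul0n ?ltn_add2l // ltn_addl.
Qed.

Lemma lex_lt_val p q s : lex_lt p q s -> size p = size s ->
  bits_val p < bits_val [seq nth false q j | j <- s].
Proof.
elim: p s => [|b p IHp] [|j s] //=.
case qj: (onth q j) => [c|] //.
have -> : nth false q j = c by apply: onth_nth.
case: ifP => [/(eqbP b _) ->|/(eqbP b _) bc] /[swap] -[sps].
  by move=> /IHp/(_ sps); rewrite size_map sps ltn_add2l.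
move=> cT; rewrite cT in bc *; case: b bc => [/(_ erefl)//|_] /=.
rewrite mul0n mul1n size_map -sps add0n.
by apply: leq_trans (bits_val_lt p) _; apply: leq_addr.
Qed.

(** Replacing a string by a larger reordering raises its binary value, which is below [2 ^ n], so
    the process stops. [L] need not be a group of symmetries: a smaller [L] leaves more strings, but
    loses none. *)
Lemma lex_max (X : Type) (P : X -> Prop) (code : X -> seq bool) n
    (L : seq (seq nat)) :
  (forall x, P x -> size (code x) = n) ->
  (forall x s, P x -> s \in L -> size s = n /\
     exists2 y, P y & code y = [seq nth false (code x) j | j <- s]) ->
  forall x, P x ->
  exists2 y, P y & forall i s, s \in L -> ~~ lex_lt (take i (code y)) (take i (code y)) s.
Proof.
move=> sz act x; have [k] := ubnP (2 ^ n - bits_val (code x)).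
elim: k x => // k IHk x ltk Px.
case: (boolP (has (lex_lt (code x) (code x)) L)) => [/hasP[s sL lt]|max].
  have [size_s [y Py yE]] := act x s Px sL.
  have lt_val : bits_val (code x) < bits_val (code y).
    by rewrite yE; apply: lex_lt_val; rewrite ?sz.
  apply: IHk Py; apply: leq_trans (ltnSE ltk); apply: ltn_sub2l => //.
  by rewrite -(sz _ Px) bits_val_lt.
exists x => // i s sL; apply: contra max => /lex_lt_take lt.
by apply/hasP; exists s.
Qed.

End BitStrings.

Definition lookup_rows (D : seq (seq nat)) (p : seq bool) :=
  map (map (nth false p)) D.

Fixpoint eq_counts (s t : seq BinNat.N.t) :=
  match s, t with
  | [::], [::] => true
  | x :: s', y :: t' => if BinNat.N.eqb x y then eq_counts s' t' else false
  | _, _ => false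
  end.

Lemma eq_countsP s t : map BinNat.N.to_nat s = map BinNat.N.to_nat t ->
  eq_counts s t.
Proof.
elim: s t => [|x s IHs] [|y t] //= [/Nnat.N2Nat.inj -> /IHs ->].
by rewrite BinNat.N.eqb_refl.
Qed.

(** * Regular graphs on at most eight vertices *)

Definition edges n :=
  [seq ij <- allpairs pair (iota 0 n) (iota 0 n) | ij.1 < ij.2].

(** A diagonal pair is not an edge and gets the index past the end, where strings read as [false]
    and [onth] gives [None]. *)
Definition edge_index n : seq (seq nat) :=
  [seq [seq index (minn i j, maxn i j) (edges n) | j <- iota 0 n]
  | i <- iota 0 n].

(** Only adjacent transpositions, to keep the test of a prefix cheap. *)
Definition swaps n : seq (seq nat) :=
  [seq [seq if i == k then k.+1 else if i == k.+1 then k else i | i <- iota 0 n]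
  | k <- iota 0 n.-1].

Definition edge_perm n (t : seq nat) :=
  [seq nth 0 (nth [::] (edge_index n) (nth 0 t ij.1)) (nth 0 t ij.2)
  | ij <- edges n].

(** A vertex with more than [k] neighbours, or more than [n - 1 - k] non-neighbours, among the
    decided pairs cannot have degree [k]. *)
Definition regular_bad n k (ix L : seq (seq nat)) (p : seq bool) :=
  if lhas (fun r =>
    if k < count (fun j => if onth p j is Some b then b else false) r then true
    else n < k.+1 + count (fun j => if onth p j is Some b then ~~ b else false) r)
    ix then true
  else lhas (lex_lt p p) L.

(** A regular graph need not be vertex-transitive, so the closed walks are summed over all vertices;
    these are the traces of the powers 1 to [l]. *)
Definition trace_key (M : seq (seq bool)) l :=
  foldr (fun i v => map (fun xy => BinNat.N.add xy.1 xy.2)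
                      (zip (walks M i (unitv (size M) i) l) v))
    (nseq l BinNat.N.zero) (iota 0 (size M)).

Definition regular_leaves n k :=
  let ix := edge_index n in
  let L := [seq edge_perm n t | t <- swaps n] in
  leaves (regular_bad n k ix L) (size (edges n)) [::].

Definition regular_check l n k :=
  let g := [seq (trace_key M l, M)
           | M <- map (lookup_rows (edge_index n)) (regular_leaves n k)] in
  lall (fun c => lall (fun c' =>
    if eq_counts c.1 c'.1 then iso_search c.2 (numbered c'.2) [::] else true) g) g.


Lemma mem_edges n i j : ((i, j) \in edges n) = (i < j < n).
Proof.
rewrite mem_filter /=; case: ltnP => //= ltij.
apply/allpairsP/idP => [[[a b] /= [_]]|ltjn]; last first.
  by exists (i, j); rewrite /= !mem_iota !add0n ltjn (ltn_trans ltij).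
by rewrite mem_iota => /andP[_ ltbn] [_ ->].
Qed.

Section EdgeCode.

Variables (T : finType) (e : rel T) (x0 : T).
Hypothesis e_simple : simple_graph e.

Definition edge_code s :=
  [seq e (nth x0 s ij.1) (nth x0 s ij.2) | ij <- edges (size s)].

Lemma onth_edge_code s i j : i < size s -> j < size s ->
  onth (edge_code s) (index (minn i j, maxn i j) (edges (size s))) =
  if i == j then None else Some (e (nth x0 s i) (nth x0 s j)).
Proof.
move=> lti ltj; have [<-|ij] := eqVneq i j.
  by rewrite onth_default // size_map memNindex // mem_edges minnn maxnn ltnn.
have ijE : (minn i j, maxn i j) \in edges (size s).
  rewrite mem_edges gtn_max lti ltj andbT.
  by move: ij; case: (ltngtP i j) => // ->.
rewrite onthE /edge_code -map_comp (nth_map (0, 0)) ?index_mem // nth_index //=.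
by case: (ltngtP i j) ij => // _ _; rewrite e_simple.1.
Qed.

Lemma nth_edge_code s i j : i < size s -> j < size s ->
  nth false (edge_code s) (index (minn i j, maxn i j) (edges (size s))) =
  e (nth x0 s i) (nth x0 s j).
Proof.
move=> lti ltj; rewrite -odflt_onth onth_edge_code //.
by have [->|//] := eqVneq; rewrite e_simple.2.
Qed.

Lemma edge_rows s : adj_rows e s = lookup_rows (edge_index (size s)) (edge_code s).
Proof.
rewrite /adj_rows /lookup_rows /edge_index -map_comp.
rewrite -{1 2}(mkseq_nth x0 s) -map_comp; apply/eq_in_map=> i.
rewrite mem_iota /= => lti; rewrite -!map_comp; apply/eq_in_map=> j.
by rewrite mem_iota /= => ltj; rewrite nth_edge_code.
Qed.

Lemma edge_code_perm s t : perm_eq t (iota 0 (size s)) ->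
  edge_code [seq nth x0 s i | i <- t] =
  [seq nth false (edge_code s) j | j <- edge_perm (size s) t].
Proof.
move=> tP; have size_t : size t = size s by rewrite (perm_size tP) size_iota.
have t_lt i : i < size s -> nth 0 t i < size s.
  move=> lti; have : nth 0 t i \in t by rewrite mem_nth ?size_t.
  by rewrite (perm_mem tP) mem_iota.
rewrite [LHS]/edge_code size_map size_t -map_comp; apply/eq_in_map=> -[i j].
rewrite mem_edges => /andP[ltij ltj]; have lti := ltn_trans ltij ltj.
rewrite /= !(nth_map 0) ?size_t ?size_iota ?t_lt // !nth_iota ?t_lt //=.
by rewrite nth_edge_code ?t_lt.
Qed.

Lemma count_regular s i k : regular e k -> uniq s -> (forall x, x \in s) ->
  i < size s -> count (fun j => e (nth x0 s i) (nth x0 s j)) (iota 0 (size s)) = k.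
Proof.
move=> ek s_uniq s_all lti; rewrite -(ek (nth x0 s i)).
have -> : #|e (nth x0 s i)| = count (e (nth x0 s i)) s.
  rewrite cardE /enum_mem size_filter -enumT.
  apply/seq.permP; rewrite uniq_perm ?enum_uniq // => x.
  by rewrite mem_enum s_all.
by set y := nth x0 s i; rewrite -[in RHS](mkseq_nth x0 s) count_map.
Qed.

Lemma regular_not_bad s k L i : regular e k -> uniq s -> (forall x, x \in s) ->
  (forall t, t \in L -> ~~ lex_lt (take i (edge_code s)) (take i (edge_code s)) t) ->
  ~~ regular_bad (size s) k (edge_index (size s)) L (take i (edge_code s)).
Proof.
move=> ek s_uniq s_all lexL; rewrite /regular_bad.
have -> : lhas (lex_lt (take i (edge_code s)) (take i (edge_code s))) L = false.
  by rewrite lhasE; apply/hasPn.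
rewrite lhasE; case: hasP => // -[r /mapP[v]]; rewrite mem_iota /= => ltv -> {r}.
have sub (b : bool) j : j < size s ->
    (if onth (take i (edge_code s)) (index (minn v j, maxn v j) (edges (size s)))
     is Some c then c == b else false) ->
    (v != j) && (e (nth x0 s v) (nth x0 s j) == b).
  move=> ltj; case cE: (onth _ _) => [c|] // /eqP cb.
  have := onth_take cE; rewrite onth_edge_code //.
  by case: eqP => // _ [->]; rewrite cb eqxx.
have cnt := count_regular ek s_uniq s_all ltv.
have sub_count b : count (fun j => if onth (take i (edge_code s))
      (index (minn v j, maxn v j) (edges (size s))) is Some c then c == b
      else false) (iota 0 (size s)) <=
    count (fun j => (v != j) && (e (nth x0 s v) (nth x0 s j) == b))
      (iota 0 (size s)).
  rewrite -!size_filter; apply: uniq_leq_size.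
    by rewrite filter_uniq ?iota_uniq.
  move=> j; rewrite !mem_filter => /andP[jb jin]; rewrite jin andbT.
  by apply: sub jb; rewrite mem_iota in jin.
rewrite !count_map; case: ltnP => [|_] /=.
  rewrite ltnNge => /negP[]; rewrite -cnt.
  apply: leq_trans (leq_trans _ (sub_count true)) _.
    by apply/eq_leq/eq_count=> j /=; case: (onth _ _) => [[]|].
  by apply: seq.sub_count => j /andP[_ /eqP->].
rewrite ltnNge => /negP[].
have sE : size s = k
   + count (fun j => ~~ e (nth x0 s v) (nth x0 s j)) (iota 0 (size s)).
  by rewrite -cnt count_predC size_iota.
rewrite [X in _ <= X]sE addSnnS leq_add2l.
(* The vertex [v] is not adjacent to itself, whence the successor, matching the [k.+1] in
   [regular_bad]. *)
have -> : count (fun j => ~~ e (nth x0 s v) (nth x0 s j)) (iota 0 (size s)) =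
  (count (fun j => (v != j) && (e (nth x0 s v) (nth x0 s j) == false))
      (iota 0 (size s))).+1.
  rewrite -add1n -[X in X + _](_ : count_mem v (iota 0 (size s)) = 1%N); last first.
    by rewrite count_uniq_mem ?iota_uniq // mem_iota ltv.
  rewrite -count_predUI [X in _ + X](_ : _ = 0) ?addn0; last first.
    rewrite (@eq_count _ _ pred0) ?count_pred0 // => j /=.
    by rewrite eq_sym; case: eqP.
  apply: eq_count => j /=; rewrite eq_sym; case: eqP => [->|_] /=.
    by rewrite e_simple.2.
  by rewrite eqbF_neg.
rewrite ltnS; apply: leq_trans (sub_count false).
by apply/eq_leq/eq_count=> j /=; case: (onth _ _) => [[]|].
Qed.

End EdgeCode.

Lemma trace_key_spec (T : finType) (e : rel T) (x0 : T) s l :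
  uniq s -> (forall x, x \in s) ->
  map BinNat.N.to_nat (trace_key (adj_rows e s) l) =
  [seq \sum_x nwalks e j x x | j <- iota 1 l].
Proof.
move=> s_uniq s_all; have es : enclosed e s by split.
rewrite /trace_key size_map.
have sumE j : \sum_x nwalks e j x x =
    \sum_(i <- iota 0 (size s)) nwalks e j (nth x0 s i) (nth x0 s i).
  transitivity (\sum_(x <- s) nwalks e j x x); last first.
    by rewrite -{1}(mkseq_nth x0 s) big_map.
  by rewrite [RHS]big_uniq //; apply: eq_bigl => x; rewrite s_all.
under [RHS]eq_map do rewrite sumE.
have : all (gtn (size s)) (iota 0 (size s)).
  by apply/allP=> i; rewrite mem_iota.
elim: (iota 0 (size s)) => [_|i I IHI /andP[lti /IHI {}IHI]] /=.
  rewrite map_nseq; elim: l 1%N => //= l IHl j.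
  by rewrite big_nil -IHl.
move: IHI (walks_spec x0 l es lti).
move: (foldr _ _ _) (walks _ _ _ _) => v w; elim: l 1%N v w => [|l IHl] j [|a v] [|b w] //.
case=> aE vE [bE wE]; congr (_ :: _); last exact: IHl.
by rewrite [LHS]Nnat.N2Nat.inj_add aE bE big_cons.
Qed.

(** Each graph has an ordering of its vertices whose code is among the leaves; cospectrality makes
    their keys equal, so the check provides an isomorphism. *)
Lemma regular_iso_small l n k (T T' : finType) (e : rel T) (e' : rel T') :
  0 < n -> all (fun t => perm_eq t (iota 0 n)) (swaps n) -> regular_check l n k ->
  #|T| = n -> #|T'| = n -> simple_graph e -> simple_graph e' ->
  regular e k -> regular e' k -> cospectral e e' -> graph_iso e e'.
Proof.
move=> n_gt0 /allP swapP check cT cT' eS eS' ek ek' cos.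
have walkE := (cospectral_nwalks eS.1 eS'.1).1 cos.
have pick (U : finType) (f : rel U) : #|U| = n -> simple_graph f -> regular f k ->
    exists y0 : U, exists s : seq U, [/\ uniq s, forall x, x \in s, size s = n
      & edge_code f y0 s \in regular_leaves n k].
  move=> cU fS fk; have /card_gt0P[y0 _] : 0 < #|U| by rewrite cU.
  exists y0; pose P (s : seq U) := [/\ uniq s, forall x, x \in s & size s = n].
  have P0 : P (enum U).
    by split; [exact: enum_uniq | by move=> x; rewrite mem_enum | rewrite -cardE].
  have [||s [s_uniq s_all size_s] lex_s] := @lex_max _ P (edge_code f y0)
    (size (edges n)) [seq edge_perm n t | t <- swaps n] _ _ _ P0.
  - by move=> s [_ _ size_s]; rewrite size_map size_s.
  - move=> s _ [s_uniq s_all size_s] /mapP[t /swapP tP ->].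
    rewrite size_map; split=> //.
    exists [seq nth y0 s i | i <- t]; last first.
      by rewrite edge_code_perm ?size_s.
    have ps : perm_eq [seq nth y0 s i | i <- t] s.
      by rewrite -[X in perm_eq _ X](mkseq_nth y0 s) perm_map // size_s.
    split; first by rewrite (perm_uniq ps).
      by move=> x; rewrite (perm_mem ps).
    by rewrite (perm_size ps).
  exists s; split=> //; rewrite -[edge_code _ _ _]cat0s; apply: mem_leaves.
    by rewrite size_map size_s.
  move=> i; rewrite cat0s -size_s; apply: regular_not_bad => // t tL.
  by apply: lex_s; rewrite -size_s.
have [y [s [s_uniq s_all size_s sL]]] := pick _ _ cT eS ek.
have [y' [s' [s'_uniq s'_all size_s' s'L]]] := pick _ _ cT' eS' ek'.
apply: (graph_iso_rows y' eS eS' s_uniq s_all s'_uniq s'_all).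
  by rewrite size_s size_s'.
apply: iso_searchP; move: check.
rewrite (edge_rows y eS) (edge_rows y' eS') size_s size_s' /regular_check lallE.
set g := map _ _ => /allP/(_ (trace_key (adj_rows e s) l, adj_rows e s)).
rewrite map_f; last first.
  by rewrite (edge_rows y eS) size_s map_f.
rewrite lallE => /(_ isT)/allP/(_ (trace_key (adj_rows e' s') l, adj_rows e' s')).
rewrite map_f; last first.
  by rewrite (edge_rows y' eS') size_s' map_f.
rewrite /= eq_countsP => [/(_ isT)|]; last first.
  rewrite (trace_key_spec _ y) // (trace_key_spec _ y') //.
  by apply: eq_map => j; rewrite walkE.
by rewrite (edge_rows y eS) (edge_rows y' eS') size_s size_s'.
Qed.

(** Degrees below half the number of vertices suffice, the others being treated by complements. Five
    traces already separate these graphs. *)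
Lemma small_checks : [&& lall (regular_check 5 8) (iota 0 4),
  lall (regular_check 5 4) (iota 0 2), regular_check 5 2 0
  & all (fun n => all (fun t => perm_eq t (iota 0 n)) (swaps n)) [:: 2; 4; 8]].
Proof. by vm_cast_no_check (erefl true). Qed.

Lemma cospectral_regular_iso n k (T T' : finType) (e : rel T) (e' : rel T') :
  n \in [:: 2; 4; 8] -> #|T| = n -> simple_graph e -> simple_graph e' ->
  regular e k -> cospectral e e' -> graph_iso e e'.
Proof.
move=> nP cT eS eS' ek cos.
have ek' := cospectral_regular eS.1 eS'.1 ek cos.
have cT' : #|T'| = n.
  by rewrite -cT -(size_spectrum e) -(size_spectrum e') (perm_size cos).
have := small_checks; rewrite !lallE.
have := @regular_iso_small 5 n _ _ _ e e'.
have := @regular_iso_small 5 n _ _ _ (graph_compl e) (graph_compl e').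
move: (regular_check 5) => check iso_compl iso_e.
case/and4P=> ck8 ck4 ck2 /allP/(_ n nP) swapP.
have n_gt0 : 0 < n by move: nP; rewrite !inE => /or3P[] /eqP->.
have small k' : k'.*2 < n -> check n k'.
  move: nP; rewrite !inE => /or3P[] /eqP->; rewrite -addnn.
  - by case: k' => // k'; rewrite addnS.
  - case: (ltnP k' 2) => [k'lt _|]; last by case: k' => [|[|k']] //; rewrite !addnS.
    by apply: (allP ck4); rewrite mem_iota.
  case: (ltnP k' 4) => [k'lt _|]; first by apply: (allP ck8); rewrite mem_iota.
  by case: k' => [|[|[|[|k']]]] //; rewrite !addnS.
have [ltk|gek] := ltnP k.*2 n.
  exact: (iso_e k n_gt0 swapP (small k ltk)).
apply: (graph_iso_compl eS.2 eS'.2).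
have cS := graph_compl_regular eS.2 ek; have cS' := graph_compl_regular eS'.2 ek'.
rewrite cT cT' in cS cS'.
have lt2 : (n - k).-1.*2 < n.
  have le1 : (n - k).*2 <= n.
    by rewrite doubleB leq_subLR -[n.*2]addnn leq_add2r.
  case: (n - k) le1 => [//|m] /=; rewrite doubleS => /ltnW; exact.
apply: (iso_compl _ n_gt0 swapP (small _ lt2)) => //.
- by split; [exact/graph_compl_sym/eS.1 | move=> x; rewrite /graph_compl eqxx].
- by split; [exact/graph_compl_sym/eS'.1 | move=> x; rewrite /graph_compl eqxx].
exact: cospectral_compl ek ek' cos.
Qed.

(** * Multiplication tables *)

Definition tget (tb : seq (seq nat)) i j := nth 0 (nth [::] tb i) j.

Definition square (tb : seq (seq nat)) :=
  all (fun r => (size r == size tb) && all (gtn (size tb)) r) tb.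

(** [s] may list a proper subgroup of [gT], so a table found inside a group can be used like the
    table of the whole group. *)
Definition model (gT : finGroupType) (s : seq gT) tb :=
  [/\ uniq s, size s = size tb, square tb, nth 1 s 0 = 1
    & forall i j, i < size tb -> j < size tb ->
        nth 1 s i * nth 1 s j = nth 1 s (tget tb i j)].

Lemma tget_lt tb i j : square tb -> i < size tb -> tget tb i j < size tb.
Proof.
move=> /allP sq lti; have /sq/andP[/eqP sz /allP r_lt] := mem_nth [::] lti.
have [ltj|gej] := ltnP j (size tb); last first.
  by rewrite /tget nth_default ?sz // (leq_ltn_trans _ lti).
by apply: r_lt; rewrite mem_nth ?sz.
Qed.

Definition dbl (tb : seq (seq nat)) h s := s ++ map (fun x => tget tb x h) s.

(* The table of the group with elements [s_i] and [s_i g], where conjugation by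
   [g] maps [s_i] to [s_(sg i)] and [g ^+ 2 = s_n]. *)
Definition ext tb (sg : seq nat) n : seq (seq nat) :=
  let m := size tb in
  map (fun r => r ++ map (addn m) r) tb ++
  map (fun r => map (fun j => m + nth 0 r j) sg ++
                map (fun j => tget tb (nth 0 r j) n) sg) tb.

Section ExtTable.

Variables (tb : seq (seq nat)) (sg : seq nat) (n : nat).
Hypotheses (sq : square tb) (size_sg : size sg = size tb).

Let m := size tb.

Lemma size_row i : i < m -> size (nth [::] tb i) = m.
Proof. by move=> lti; have /(allP sq)/andP[/eqP] := mem_nth [::] lti. Qed.

Lemma size_ext : size (ext tb sg n) = m + m.
Proof. by rewrite size_cat !size_map. Qed.

Lemma tget_ext_ll i j : i < m -> j < m -> tget (ext tb sg n) i j = tget tb i j.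
Proof.
move=> lti ltj; rewrite /tget nth_cat size_map lti (nth_map [::]) //.
by rewrite nth_cat size_row // ltj.
Qed.

Lemma tget_ext_lr i j : i < m -> j < m ->
  tget (ext tb sg n) i (m + j) = m + tget tb i j.
Proof.
move=> lti ltj; rewrite /tget nth_cat size_map lti (nth_map [::]) //.
rewrite nth_cat size_row // ltnNge leq_addr /= addKn (nth_map 0) //.
by rewrite size_row.
Qed.

Lemma tget_ext_rl i j : i < m -> j < m ->
  tget (ext tb sg n) (m + i) j = m + tget tb i (nth 0 sg j).
Proof.
move=> lti ltj; rewrite /tget nth_cat size_map -/m ltnNge leq_addr /= addKn.
by rewrite (nth_map [::]) // nth_cat size_map size_sg ltj (nth_map 0) ?size_sg.
Qed.

Lemma tget_ext_rr i j : i < m -> j < m ->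
  tget (ext tb sg n) (m + i) (m + j) = tget tb (tget tb i (nth 0 sg j)) n.
Proof.
move=> lti ltj; rewrite {1}/tget nth_cat size_map -/m ltnNge leq_addr /= addKn.
rewrite (nth_map [::]) // nth_cat size_map size_sg ltnNge leq_addr /= addKn.
by rewrite (nth_map 0) ?size_sg.
Qed.

Lemma square_ext : square (ext tb sg n).
Proof.
apply/allP=> r; rewrite size_ext mem_cat => /orP[] /mapP[r0 r0tb -> {r}].
  have /(allP sq)/andP[/eqP sz /allP r0_lt] := r0tb.
  rewrite size_cat size_map sz eqxx; apply/allP=> x.
  rewrite mem_cat => /orP[/r0_lt ltx|/mapP[y /r0_lt lty ->]] /=.
    exact: ltn_addr.
  by rewrite ltn_add2l.
have /(allP sq)/andP[/eqP sz /allP r0_lt] := r0tb.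
have r0lt j : nth 0 r0 j < m.
  have [ltj|gej] := ltnP j m; first by apply: r0_lt; rewrite mem_nth ?sz.
  rewrite nth_default ?sz //; case: (r0) sz r0_lt => [|y r1] _ lt1 //=.
    by rewrite /m; case: (tb) r0tb.
  exact: leq_ltn_trans (lt1 y (mem_head _ _)).
rewrite size_cat !size_map size_sg eqxx; apply/allP=> x.
rewrite mem_cat => /orP[] /mapP[y _ ->] /=; first by rewrite ltn_add2l.
by apply: ltn_addr; apply: tget_lt.
Qed.

End ExtTable.

(** An element [g] commutes with its square, and conjugating twice by [g] is conjugating by the
    square. The last test says that no element of the coset of [g] has a square with a smaller
    number than [n]; it discards many descriptions of the same group. *)
Definition ext_ok tb sg n :=
  let rn := nth [::] tb n in
  if eqn (nth 0 sg n) n then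
    if lall (fun i => eqn (tget tb (nth 0 sg (nth 0 sg i)) n) (nth 0 rn i))
         (iota 0 (size tb))
    then lall (fun i => n <= tget tb (tget tb i (nth 0 sg i)) n)
           (iota 0 (size tb))
    else false
  else false.

Lemma model_ext (gT : finGroupType) (G H : {group gT}) s tb :
  H \subset G -> #|G : H| = 2 -> model s tb -> H =i s ->
  exists sg n s',
    [/\ [/\ size sg = size tb, uniq sg, all (gtn (size tb)) sg, nth 0 sg 0 = 0
          & forall i j, i < size tb -> j < size tb ->
              nth 0 sg (tget tb i j) = tget tb (nth 0 sg i) (nth 0 sg j)],
        n < size tb, ext_ok tb sg n, model s' (ext tb sg n) & G =i s'].
Proof.
move=> sHG iGH [s_uniq size_s sq s0 sM] Hs.
have nHG : H <| G by apply: index2_normal.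
have m_gt0 : 0 < size tb by rewrite -size_s; have := group1 H; rewrite Hs; case: (s).
have sH i : i < size tb -> nth 1 s i \in H by move=> ?; rewrite Hs mem_nth ?size_s.
have idx x : x \in H -> index x s < size tb by rewrite Hs -size_s index_mem.
have idxK x : x \in H -> nth 1 s (index x s) = x by rewrite Hs => /nth_index->.
have s_inj i j : i < size tb -> j < size tb -> nth 1 s i = nth 1 s j -> i = j.
  by move=> ? ? /eqP; rewrite nth_uniq ?size_s // => /eqP.
have tlt i j : i < size tb -> tget tb i j < size tb by apply: tget_lt.
have [g0 g0P] : exists g, g \in G :\: H.
  apply/set0Pn; rewrite setD_eq0; apply: contraPN iGH => sGH.
  by rewrite (_ : H :=: G) ?indexgg //; apply/eqP; rewrite eqEsubset sHG.
have cosetE x : x \in G :\: H -> G :\: H = H :* x.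
  rewrite inE => /andP[xH xG]; apply/esym/eqP; rewrite eqEcard; apply/andP; split.
    apply/subsetP=> _ /rcosetP[h hH ->].
    by rewrite inE groupMl // xH groupM // (subsetP sHG).
  by rewrite cardsDS // card_rcoset -(Lagrange sHG) iGH muln2 -addnn addnK.
have sqH x : x \in G :\: H -> x * x \in H.
  move=> xGH; have := xGH; rewrite inE => /andP[xH xG].
  apply: contraR xH => xxH; have : x * x \in G :\: H by rewrite inE xxH groupM.
  by rewrite (cosetE x) // mem_rcoset mulgK.
(* This choice of [g] secures the minimality required by [ext_ok]. *)
pose g := [arg min_(g < g0 in G :\: H) index (g * g) s].
have [gP g_min] : g \in G :\: H /\
    forall x, x \in G :\: H -> index (g * g) s <= index (x * x) s.
  by rewrite /g; case: arg_minnP.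
have gG : g \in G by case/setDP: gP.
have conjH x : x \in H -> x ^ g^-1 \in H.
  by move=> xH; rewrite memJ_norm // groupV (subsetP (normal_norm nHG)).
(* Moving [g] to the right past [s_j] yields [g s_j g^-1], which is [s_j ^ g^-1]. *)
pose sg := [seq index (x ^ g^-1) s | x <- s].
have sg_nth i : i < size tb -> nth 0 sg i = index (nth 1 s i ^ g^-1) s.
  by move=> lti; rewrite (nth_map 1) ?size_s.
have sg_lt i : i < size tb -> nth 0 sg i < size tb.
  by move=> lti; rewrite sg_nth // idx ?conjH ?sH.
have sgE i : i < size tb -> nth 1 s (nth 0 sg i) = nth 1 s i ^ g^-1.
  by move=> lti; rewrite sg_nth // idxK ?conjH ?sH.
pose n := index (g * g) s.
have n_lt : n < size tb by rewrite idx ?sqH.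
have nE : nth 1 s n = g * g by rewrite idxK ?sqH.
exists sg, n, (s ++ [seq x * g | x <- s]); split=> //.
- split; first by rewrite size_map.
  + rewrite map_inj_in_uniq // => x y xs ys /(congr1 (nth 1 s)).
    by rewrite !idxK ?conjH ?Hs // => /conjg_inj.
  + by apply/allP=> _ /mapP[x xs ->]; rewrite /= idx ?conjH ?Hs.
  + by apply: s_inj; rewrite ?sg_lt // sgE // s0 conj1g.
  move=> i j lti ltj; apply: s_inj; rewrite ?sg_lt ?tlt ?sg_lt //.
  by rewrite sgE ?tlt // -!sM ?sg_lt // !sgE // conjMg.
- rewrite /ext_ok; have -> : eqn (nth 0 sg n) n.
    apply/eqP; apply: s_inj; rewrite ?sg_lt // sgE // nE.
    by rewrite /conjg invgK !mulgA mulgK.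
  have -> : lall (fun i => eqn (tget tb (nth 0 sg (nth 0 sg i)) n)
      (nth 0 (nth [::] tb n) i)) (iota 0 (size tb)).
    rewrite lallE; apply/allP=> i; rewrite mem_iota => /= lti.
    rewrite -[nth 0 (nth [::] tb n) i]/(tget tb n i).
    apply/eqP; apply: s_inj; rewrite ?tlt ?sg_lt //.
    rewrite -!sM ?sg_lt // sgE ?sg_lt // sgE // nE.
    by rewrite /conjg !invgK !mulgA !mulgKV.
  rewrite lallE; apply/allP=> i; rewrite mem_iota => /= lti.
  have -> : tget tb (tget tb i (nth 0 sg i)) n =
      index (nth 1 s i * g * (nth 1 s i * g)) s.
    rewrite -[LHS](index_uniq 1 _ s_uniq) ?size_s ?tlt //; congr index.
    rewrite -!sM ?tlt ?sg_lt // sgE // nE /conjg invgK !mulgA.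
    by rewrite mulgKV.
  by apply: g_min; rewrite (cosetE g) // mem_rcoset mulgK sH.
- split.
  + rewrite cat_uniq s_uniq map_inj_uniq ?s_uniq ?andbT; last exact: mulIg.
    apply/hasPn=> _ /mapP[x xs ->]; rewrite -Hs.
    by case/setDP: gP => _; rewrite groupMl ?Hs.
  + by rewrite size_cat size_map size_ext size_s.
  + by apply: square_ext; rewrite ?size_map.
  + by rewrite nth_cat size_s m_gt0.
  have size_sg : size sg = size tb by rewrite size_map.
  have nthl i : i < size tb -> nth 1 (s ++ [seq x * g | x <- s]) i = nth 1 s i.
    by move=> lti; rewrite nth_cat size_s lti.
  have nthr i : i < size tb ->
      nth 1 (s ++ [seq x * g | x <- s]) (size tb + i) = nth 1 s i * g.
    move=> lti; rewrite nth_cat size_s ltnNge leq_addr /= addKn.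
    by rewrite (nth_map 1) ?size_s.
  have split_lt i : i < size tb + size tb ->
      i < size tb \/ exists2 i', i' < size tb & i = size tb + i'.
    have [|gei] := ltnP i (size tb) => lti; [by left | right].
    by exists (i - size tb); rewrite ?subnKC // ltn_subLR.
  move=> i j; rewrite size_ext => /split_lt[lti|[i' lti ->]].
    move=> /split_lt[ltj|[j' ltj ->]].
      by rewrite tget_ext_ll // !nthl ?tlt ?sM.
    by rewrite tget_ext_lr // nthl // !nthr ?tlt // mulgA sM.
  have gsM j' : j' < size tb -> g * nth 1 s j' = nth 1 s (nth 0 sg j') * g.
    by move=> ltj'; rewrite sgE // /conjg invgK !mulgA mulgKV.
  move=> /split_lt[ltj|[j' ltj ->]].
    rewrite tget_ext_rl // nthr // nthl // nthr ?tlt // -mulgA gsM //.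
    by rewrite mulgA sM ?sg_lt.
  rewrite tget_ext_rr // !nthr // nthl ?tlt ?sg_lt //.
  rewrite -!sM ?tlt ?sg_lt // nE !mulgA; congr (_ * g).
  by rewrite -mulgA gsM // mulgA.
move=> x; rewrite mem_cat; have [xH|xH] := boolP (x \in H).
  by rewrite -Hs xH (subsetP sHG).
rewrite -Hs (negPf xH) /=; apply/idP/mapP => [xG|[y ys ->]]; last first.
  by rewrite groupM // (subsetP sHG) ?Hs.
have : x \in H :* g by rewrite -(cosetE g) // inE xH.
by case/rcosetP=> h hH ->; exists h; rewrite -?Hs.
Qed.

(** * Embeddings of tables determined by the images of generators *)

Fixpoint conj_ok (tb : seq (seq nat)) h (rh : seq nat) s i hs :=
  if hs is x :: hs' then
    if eqn (nth 0 rh (nth 0 s i)) (tget tb (nth 0 s x) h)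
    then conj_ok tb h rh s i.*2 hs' else false
  else true.

(** The image [h] of the next generator must satisfy the relations of that generator, transported
    along the partial map [s], and lie outside the images found so far. *)
Definition next_ok tb s (hn : seq nat * nat) h :=
  let rh := nth [::] tb h in
  if eqn (nth 0 rh h) (nth 0 s hn.2) then
    if conj_ok tb h rh s 1 hn.1 then ~~ nmem h s else false
  else false.

(* A group is described by a list [d] of pairs [(hs, n)], one for each generator
   [g]: its square is the element number [n], and [hs] lists the conjugates by
   [g] of the previous generators, which have numbers 1, 2, 4, ... *)
Fixpoint all_embeddings (d : seq (seq nat * nat)) tb s (P : pred (seq nat)) :=
  if d is hn :: d' then
    lall (fun h => if next_ok tb s hn h then all_embeddings d' tb (dbl tb h s) P
                   else true) (iota 0 (size tb))
  else P s.

(** The whole table is compared, so soundness does not rest on the search that produced [s]. *)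
Definition embedding (r tb : seq (seq nat)) s :=
  [&& size s == size r, uniq s, all (gtn (size tb)) s, nth 0 s 0 == 0
    & lall (fun xr => let r' := nth [::] tb xr.1 in
        lall (fun yc => eqn (nth 0 s yc.2) (nth 0 r' yc.1)) (zip s xr.2))
      (zip s r)].

Fixpoint embeds (d : seq (seq nat * nat)) r tb s :=
  if d is hn :: d' then
    lhas (fun h => if next_ok tb s hn h then embeds d' r tb (dbl tb h s)
                   else false) (iota 0 (size tb))
  else embedding r tb s.

(** The binary digits of the number of an element tell which generators occur in it, so the images
    [hs] of the generators determine all images. *)
Definition gens_map tb hs := foldl (fun s h => dbl tb h s) [:: 0] hs.

Definition table (d : seq (seq nat * nat)) : seq (seq nat) :=
  foldl (fun tb hn => ext tb (gens_map tb hn.1) hn.2) [:: [:: 0]] d.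

Lemma embedding_model (gT : finGroupType) (s : seq gT) tb r t :
  model s tb -> square r -> embedding r tb t -> model [seq nth 1 s i | i <- t] r.
Proof.
move=> [s_uniq size_s sq s0 sM] sqr.
case/and5P=> /eqP size_t t_uniq /allP t_lt /eqP t0 tM; split=> //.
- rewrite map_inj_in_uniq // => i j /t_lt lti /t_lt ltj /eqP.
  by rewrite nth_uniq ?size_s // => /eqP.
- by rewrite size_map.
- case: t t0 {size_t t_uniq t_lt tM} => //= i t ->; exact: s0.
move=> i j lti ltj.
have ltt k : k < size r -> nth 0 t k < size tb.
  by move=> ltk; apply: t_lt; rewrite mem_nth ?size_t.
rewrite !(nth_map 0) ?size_t ?tget_lt // sM ?ltt //; congr nth.
move: tM; rewrite lallE => /(all_nthP (0, [::]))/(_ i).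
rewrite size_zip size_t minnn nth_zip //= => /(_ lti).
rewrite lallE => /(all_nthP (0, 0))/(_ j).
rewrite size_zip size_t size_row // minnn nth_zip ?size_t ?size_row //=.
by move=> /(_ ltj)/eqP.
Qed.

Lemma embedsP d r tb s : embeds d r tb s -> exists t, embedding r tb t.
Proof.
elim: d s => [|hn d IHd] s /=; first by exists s.
by rewrite lhasE => /hasP[h _]; case: ifP => // _ /IHd.
Qed.

Fixpoint conj_form tb g i hs :=
  if hs is x :: hs' then
    [&& i < g, x < g, tget tb g i == tget tb x g & conj_form tb g i.*2 hs']
  else true.

(** The table satisfies the relations of its own description, and right multiplication by each
    generator shifts the elements before it by one block. This makes the search in [all_embeddings]
    complete. *)
Fixpoint form_ok (tb : seq (seq nat)) g (d : seq (seq nat * nat)) :=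
  if d is hn :: d' then
    [&& hn.2 < g, tget tb g g == hn.2, conj_form tb g 1 hn.1,
        all (fun i => tget tb i g == g + i) (iota 0 g) & form_ok tb g.*2 d']
  else g == size tb.

(** An automorphism preserves the relations of the description, so the images of the generators pass
    [next_ok] one after the other and the search reaches [sg]. *)
Lemma all_embeddingsP d tb P sg :
  square tb -> form_ok tb 1%N d -> all_embeddings d tb [:: 0] P ->
  size sg = size tb -> uniq sg -> all (gtn (size tb)) sg -> nth 0 sg 0 = 0 ->
  (forall i j, i < size tb -> j < size tb ->
     nth 0 sg (tget tb i j) = tget tb (nth 0 sg i) (nth 0 sg j)) ->
  P sg.
Proof.
move=> sq form allP_ size_sg sg_uniq /allP sg_lt sg0 sgM.
have sgm i : i < size tb -> nth 0 sg i < size tb.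
  by move=> lti; apply: sg_lt; rewrite mem_nth ?size_sg.
have form_le g d' : form_ok tb g d' -> g <= size tb.
  elim: d' g => [|hn d' IHd'] g /=; first by move/eqP->.
  by case/and5P=> _ _ _ _ /IHd'; apply: leq_trans; rewrite -addnn leq_addr.
(* When the generator with number [g] is treated, the search has built exactly the first [g] values
   of [sg]. *)
suff gen g : 0 < g -> form_ok tb g d -> all_embeddings d tb (take g sg) P -> P sg.
  apply: (gen 1%N) => //; have := form_le _ _ form.
  by rewrite -size_sg; case: (sg) sg0 allP_ => //= a l -> + _; rewrite take0.
elim: d {form allP_} g => [|[hs n] d IHd] g g_gt0 /=.
  by move/eqP->; rewrite -size_sg take_size.
case/and5P=> ltn /eqP gg conjf /allP shift form2.
have le2g := form_le _ _ form2; rewrite -addnn in le2g.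
have ltg : g < size tb by apply: leq_trans le2g; rewrite -addn1 leq_add2l.
rewrite lallE => /allP/(_ (nth 0 sg g)); rewrite mem_iota sgm // => /(_ isT).
have ltgm i : i < g -> i < size tb by move=> lti; apply: ltn_trans ltg.
have -> : next_ok tb (take g sg) (hs, n) (nth 0 sg g).
  rewrite /next_ok /= nth_take // -[nth 0 _ _]/(tget tb (nth 0 sg g) (nth 0 sg g)).
  rewrite -sgM // gg eqnE eqxx.
  have -> : conj_ok tb (nth 0 sg g) (nth [::] tb (nth 0 sg g)) (take g sg) 1 hs.
    elim: hs 1%N conjf => //= x hs IHhs i /and4P[lti ltx /eqP gi /IHhs->].
    rewrite !nth_take // -[nth 0 _ _]/(tget tb (nth 0 sg g) (nth 0 sg i)).
    by have ? := ltgm i lti; have ? := ltgm x ltx; rewrite -!sgM // gi eqnE eqxx.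
  rewrite nmemE; apply/negP=> /(nthP 0)[i]; rewrite size_take size_sg ltg => lti.
  rewrite nth_take // => /eqP; rewrite nth_uniq ?size_sg // ?ltgm // => /eqP ig.
  by rewrite ig ltnn in lti.
have -> : dbl tb (nth 0 sg g) (take g sg) = take g.*2 sg; last first.
  by apply: IHd; rewrite ?double_gt0.
rewrite /dbl -addnn; apply: (@eq_from_nth _ 0) => [|i].
  by rewrite size_cat size_map !size_take size_sg ltg; case: ltngtP le2g => // ->.
rewrite size_cat size_map size_take size_sg ltg => lti.
rewrite nth_take // nth_cat size_take size_sg ltg.
have [ltig|geig] := ltnP i g; first by rewrite nth_take.
have ltig : i - g < g by rewrite ltn_subLR.
rewrite (nth_map 0) ?size_take ?size_sg ?ltg // nth_take // -sgM // ?ltgm //.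
by have := shift (i - g); rewrite mem_iota /= => /(_ ltig)/eqP->; rewrite subnKC.
Qed.

(** * Classification of the groups of order at most 16 *)

Definition extensions_ok d (Q : pred (seq (seq nat))) :=
  let tb := table d in
  all_embeddings d tb [:: 0] (fun sg =>
    lall (fun n => if ext_ok tb sg n then Q (ext tb sg n) else true)
      (iota 0 (size tb))).

(** Every admissible extension of a group in [R] contains a copy of some group in [R']. The copy may
    be proper: with [bad32] as [R'] it has order 16 or 32. *)
Definition classify_check (R R' : seq (seq (seq nat * nat))) :=
  let R1 := [seq (d', table d') | d' <- R'] in
  lall (fun d => extensions_ok d (fun tb =>
    lhas (fun c => embeds c.1 c.2 tb [:: 0]) R1)) R.

Definition well_formed d := square (table d) && form_ok (table d) 1%N d.

Lemma classify_step (gT : finGroupType) (G H : {group gT}) R R' d s :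
  H \subset G -> #|G : H| = 2 -> all well_formed R -> all well_formed R' ->
  classify_check R R' -> d \in R -> model s (table d) -> H =i s ->
  exists d' s', [/\ d' \in R', model s' (table d') & {subset s' <= G}].
Proof.
move=> sHG iGH /allP wfR /allP wfR' check dR sd Hs.
have [sg [n [s1 [[size_sg sg_uniq sg_lt sg0 sgM] n_lt okn s1M Gs1]]]] :=
  model_ext sHG iGH sd Hs.
have /andP[sq form] := wfR d dR.
move: check; rewrite /classify_check lallE => /allP/(_ d dR).
move/(all_embeddingsP sq form)/(_ size_sg sg_uniq sg_lt sg0 sgM).
rewrite lallE => /allP/(_ n); rewrite mem_iota n_lt okn => /(_ isT).
rewrite lhasE => /hasP[_ /mapP[d' d'R' ->] /= /embedsP[t tP]].
have /andP[sq' _] := wfR' d' d'R'.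
exists d', [seq nth 1 s1 i | i <- t]; split=> //.
  exact: embedding_model tP.
move=> _ /mapP[i it ->]; rewrite Gs1 mem_nth //.
case: s1M => _ -> _ _ _; case/and5P: tP => _ _ /allP/(_ i it) //.
Qed.

Definition groups2 : seq (seq (seq nat * nat)) := [:: [:: ([::], 0)]].

Definition groups4 : seq (seq (seq nat * nat)) :=
  [:: [:: ([::], 0); ([:: 1%N], 0)]; [:: ([::], 0); ([:: 1%N], 1%N)]].

(** In order: [C2^3], [C4 x C2], [D8], [C8], [Q8]. *)
Definition groups8 : seq (seq (seq nat * nat)) :=
  [:: [:: ([::], 0); ([:: 1%N], 0); ([:: 1%N; 2], 0)];
      [:: ([::], 0); ([:: 1%N], 0); ([:: 1%N; 2], 1%N)];
      [:: ([::], 0); ([:: 1%N], 0); ([:: 1%N; 3], 0)];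
      [:: ([::], 0); ([:: 1%N], 1%N); ([:: 1%N; 2], 2)];
      [:: ([::], 0); ([:: 1%N], 1%N); ([:: 1%N; 3], 1%N)]].

Section Data.

Local Open Scope nat_scope.

Definition gC2xQ8 : seq (seq nat * nat) :=
  [:: ([::], 0); ([:: 1], 0); ([:: 1; 2], 1); ([:: 1; 2; 5], 1)].

(** The central product of [C4], generated by 4, and [D8], generated by 2 and 8. *)
Definition gC4oD8 : seq (seq nat * nat) :=
  [:: ([::], 0); ([:: 1], 0); ([:: 1; 2], 1); ([:: 1; 3; 4], 0)].

(** In order: [C8 x C2], the modular group, [C4 x C4], [C4 x C2 x C2], [D8 x C2], [C2^2 : C4],
    [C2^4], [C4 : C4], [D16], the semidihedral group, [C16], [Q16]. *)
Definition bad16 : seq (seq (seq nat * nat)) :=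
  [:: [:: ([::], 0); ([:: 1], 0); ([:: 1; 2], 1); ([:: 1; 2; 4], 4)];
      [:: ([::], 0); ([:: 1], 0); ([:: 1; 2], 1); ([:: 1; 3; 4], 4)];
      [:: ([::], 0); ([:: 1], 0); ([:: 1; 2], 1); ([:: 1; 2; 4], 2)];
      [:: ([::], 0); ([:: 1], 0); ([:: 1; 2], 0); ([:: 1; 2; 4], 1)];
      [:: ([::], 0); ([:: 1], 0); ([:: 1; 2], 0); ([:: 1; 2; 5], 0)];
      [:: ([::], 0); ([:: 1], 0); ([:: 1; 2], 0); ([:: 1; 2; 5], 2)];
      [:: ([::], 0); ([:: 1], 0); ([:: 1; 2], 0); ([:: 1; 2; 4], 0)];
      [:: ([::], 0); ([:: 1], 0); ([:: 1; 2], 1); ([:: 1; 2; 5], 2)];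
      [:: ([::], 0); ([:: 1], 0); ([:: 1; 3], 0); ([:: 1; 4; 2], 0)];
      [:: ([::], 0); ([:: 1], 0); ([:: 1; 3], 0); ([:: 1; 4; 2], 1)];
      [:: ([::], 0); ([:: 1], 1); ([:: 1; 2], 2); ([:: 1; 2; 4], 4)];
      [:: ([::], 0); ([:: 1], 1); ([:: 1; 2], 2); ([:: 1; 3; 7], 1)]].

(** The central product of [D8], generated by 2 and 8, and [Q8], generated by 4 and 16. *)
Definition gExtraspecial32 : seq (seq nat * nat) :=
  [:: ([::], 0); ([:: 1], 0); ([:: 1; 2], 1); ([:: 1; 3; 4], 0);
      ([:: 1; 2; 5; 8], 1)].

Definition good16 := [:: gC2xQ8; gC4oD8].

Definition groups16 := bad16 ++ good16.

Definition bad32 := rcons bad16 gExtraspecial32.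

Definition chain := [:: [:: [::]]; groups2; groups4; groups8; groups16].

End Data.

Lemma data_well_formed : all well_formed (bad32 ++ flatten chain) &&
  all (fun k => all (fun d => size (table d) == (2 ^ k)%N) (nth [::] chain k))
    (iota 0 5).
Proof. by vm_cast_no_check (erefl true). Qed.

Lemma classify_check_chain :
  all (fun k => classify_check (nth [::] chain k) (nth [::] chain k.+1)) (iota 0 4).
Proof. by vm_cast_no_check (erefl true). Qed.

Lemma classify_check32 : classify_check good16 bad32.
Proof. by vm_cast_no_check (erefl true). Qed.

Lemma classification (gT : finGroupType) (G : {group gT}) k :
  k <= 4 -> #|G| = (2 ^ k)%N ->
  exists d s, [/\ d \in nth [::] chain k, model s (table d) & G =i s].
Proof.
have := classify_check_chain; have := data_well_formed.
move: classify_check (@classify_step gT) => check step.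
case/andP=> /allP wf /allP sz /allP ck.
elim: k G => [|k IHk] G lek cG.
  have G1 : G :=: 1 by apply/card1_trivg.
  exists [::], [:: 1]; split=> //; last by move=> x; rewrite G1 !inE.
  by split=> // -[|i] [|j] //= _ _; rewrite mulg1.
have pG : 2.-group G by rewrite /pgroup cG pnatX.
have [H [sHG _ cH]] : exists H : {group gT}, [/\ H \subset G, H <| G & #|H| = (2 ^ k)%N].
  by apply: (normal_pgroup pG (normal_refl G)); rewrite cG pfactorK.
have iGH : #|G : H| = 2 by rewrite -divgS // cG cH expnS mulnK // expn_gt0.
have [d [s [dk sd Hs]]] := IHk H (ltnW lek) cH.
have in_chain j : j <= 4 -> {subset nth [::] chain j <= bad32 ++ flatten chain}.
  move=> lej d' d'j; rewrite mem_cat; apply/orP; right.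
  by apply/flattenP; exists (nth [::] chain j); rewrite ?mem_nth.
have ltk : k \in iota 0 4 by rewrite mem_iota.
have ltk1 : k.+1 \in iota 0 5 by rewrite mem_iota.
have [||d' [s' [d'k s'd' sG]]] := step G H _ _ d s sHG iGH _ _ (ck k ltk) dk sd Hs.
- by apply/allP=> d' /in_chain d'k; apply: wf; apply: d'k; apply: ltnW.
- by apply/allP=> d' /in_chain d'k; apply: wf; apply: d'k.
exists d', s'; split=> // x; apply/idP/idP => [|/sG //].
have [s'_uniq size_s' _ _ _] := s'd'.
have /eqP sz' : size (table d') == (2 ^ k.+1)%N by apply: (allP (sz _ ltk1)).
(* The copy found inside [G] has as many elements as [G], so it is all of [G]. *)
have [|| _ eqs] := uniq_min_size s'_uniq (s2 := enum G).
- by move=> y /sG; rewrite mem_enum.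
- by rewrite -cardE cG size_s' sz'.
by rewrite eqs mem_enum.
Qed.

(** * Cayley graphs and multiplication tables *)

Section CayleyGraph.

Variables (gT : finGroupType) (S : {set gT}).

Lemma cayley_regular : regular (cayley S) #|S|.
Proof.
move=> x; have inj : injective (fun y : gT => x * y^-1).
  by move=> y z /mulgI/invg_inj.
rewrite -(card_imset _ inj).
apply: eq_card => y; apply/imsetP/idP => [[z zS ->] //|yS].
by exists (y^-1 * x); rewrite ?unfold_in /cayley invMg invgK mulKVg.
Qed.

Lemma cayley_translate g x y : cayley S (x * g) (y * g) = cayley S x y.
Proof. by rewrite /cayley invMg mulgA mulgK. Qed.

Lemma nwalks_translate j g x y :
  nwalks (cayley S) j (x * g) (y * g) = nwalks (cayley S) j x y.
Proof.
elim: j x => [|j IHj] x /=; first by rewrite (inj_eq (mulIg g)).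
rewrite (reindex_inj (mulIg g)) /=.
by apply: eq_big => [z|z _]; rewrite ?cayley_translate.
Qed.

(** Right translations are automorphisms, so every vertex has as many closed walks as the
    identity. *)
Lemma sum_nwalks_cayley j :
  \sum_x nwalks (cayley S) j x x = (#|gT| * nwalks (cayley S) j 1%g 1%g)%N.
Proof.
rewrite -sum_nat_const; apply: eq_bigr => x _.
by rewrite -{1 2}[x]mul1g nwalks_translate.
Qed.

End CayleyGraph.

Definition invs (tb : seq (seq nat)) := map (find (eqn 0)) tb.

(** Entry [i, j] is the number of [s_i s_j^-1], whose membership in the connection set decides
    adjacency. *)
Definition divt tb := let iv := invs tb in map (fun r => map (nth 0 r) iv) tb.

Definition has_invs (tb : seq (seq nat)) := all (nmem 0) tb.

Section ModelCayley.

Variables (gT : finGroupType) (S : {set gT}) (s : seq gT) (tb : seq (seq nat)).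
Hypotheses (sM : model s tb) (iv : has_invs tb).

Lemma nth_invs i : i < size tb ->
  nth 0 (invs tb) i < size tb /\ nth 1 s (nth 0 (invs tb) i) = (nth 1 s i)^-1.
Proof.
move=> lti; have [_ _ sq s0 mulE] := sM; rewrite (nth_map [::]) //.
have := allP iv _ (mem_nth [::] lti); rewrite /nmem lhasE => has0.
have lt_find : find (eqn 0) (nth [::] tb i) < size tb.
  by rewrite -[X in _ < X](size_row sq lti) -has_find.
split=> //; apply/esym/eqP; rewrite eq_invg_mul mulE //.
by have /eqP := nth_find 0 has0; rewrite /tget => <-; rewrite s0.
Qed.

Lemma cayley_rows : adj_rows (cayley S) s = lookup_rows (divt tb) [seq x \in S | x <- s].
Proof.
have [_ size_s sq _ mulE] := sM.
rewrite /adj_rows /lookup_rows /divt -map_comp.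
apply: (@eq_from_nth _ [::]); rewrite ?size_map // => i; rewrite size_s => lti.
rewrite (nth_map 1) ?size_s // (nth_map [::]) // /comp -map_comp.
apply: (@eq_from_nth _ false); rewrite ?size_map // => j; rewrite size_s => ltj.
rewrite (nth_map 1) ?size_s // (nth_map 0) ?size_map //=.
have [ltv vE] := nth_invs ltj.
rewrite (nth_map 1) ?size_s -/(tget _ _ _) ?tget_lt //.
by rewrite -mulE // vE.
Qed.

Lemma cayley_enclosed : connection_set S -> {subset S <= s} ->
  enclosed (cayley S) s.
Proof.
move=> [_ SV] sS; have [s_uniq size_s sq _ mulE] := sM; split=> // x y xs.
rewrite /cayley -SV mem_invg invMg invgK => /sS yxs.
have /(nthP 1)[i lti iE] := yxs; have /(nthP 1)[j ltj jE] := xs.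
rewrite size_s in lti ltj.
rewrite -[y](mulgKV x) -iE -jE mulE // mem_nth // size_s; exact: tget_lt.
Qed.

End ModelCayley.

(** In a simple graph, six times the number of copies of [K4] through [u]. The spectrum does not
    determine it: the rook graph has such copies, the Shrikhande graph has none. *)
Definition k4 (T : finType) (e : rel T) u :=
  \sum_(x | e u x) \sum_(y | e u y) \sum_(z | e u z) [&& e x y, e x z & e y z].

Lemma k4_iso (T T' : finType) (e : rel T) (e' : rel T') f u : bijective f ->
  (forall x y, e' (f x) (f y) = e x y) -> k4 e' (f u) = k4 e u.
Proof.
move=> bf fE; rewrite /k4 [LHS](reindex f (onW_bij _ bf)) /=.
apply: eq_big => x; first by rewrite fE.
move=> _; rewrite [LHS](reindex f (onW_bij _ bf)) /=.
apply: eq_big => y; first by rewrite fE.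
move=> _; rewrite [LHS](reindex f (onW_bij _ bf)) /=.
by apply: eq_big => z; rewrite !fE.
Qed.

Lemma k4_cayley (gT : finGroupType) (S : {set gT}) u :
  k4 (cayley S) u = k4 (cayley S) 1.
Proof.
rewrite -{1}[u]mul1g; apply: (k4_iso (f := mulg^~ u)).
  exact: injF_bij (mulIg u).
by move=> x y; rewrite cayley_translate.
Qed.

Definition k4_rows (M : seq (seq bool)) :=
  let nb := filter (nth false (nth [::] M 0)) (iota 0 (size M)) in
  sumn (map (fun x => let rx := nth [::] M x in
    sumn (map (fun y => let ry := nth [::] M y in
      if nth false rx y then
        count (fun z => if nth false rx z then nth false ry z else false) nb
      else 0) nb)) nb).

Lemma k4_rows_spec (T : finType) (e : rel T) x0 s : enclosed e s -> 0 < size s ->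
  k4_rows (adj_rows e s) = k4 e (nth x0 s 0).
Proof.
move=> [s_uniq s_closed] s_gt0; rewrite /k4_rows size_map.
set nb := filter _ _.
have sum_nb (F : T -> nat) :
    \sum_(x | e (nth x0 s 0) x) F x = \sum_(i <- nb) F (nth x0 s i).
  rewrite big_filter; transitivity (\sum_(x <- s | e (nth x0 s 0) x) F x).
    rewrite [RHS]big_mkcond [RHS]big_uniq //= [LHS]big_mkcond [RHS]big_mkcond.
    apply: eq_bigr => x _; case: ifP => [ex|_]; last by rewrite if_same.
    by rewrite (s_closed (nth x0 s 0)) // mem_nth.
  rewrite -{1}(mkseq_nth x0 s) big_map big_seq_cond [RHS]big_seq_cond.
  apply: eq_bigl => i; rewrite mem_iota; case: ltnP => //= lti.
  by rewrite (nth_adj_rows e x0).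
have nb_lt i : i \in nb -> i < size s by rewrite mem_filter mem_iota => /andP[].
rewrite /k4 sum_nb sumnE big_map big_seq [RHS]big_seq; apply: eq_bigr => x /nb_lt ltx.
rewrite sum_nb sumnE big_map big_seq [RHS]big_seq; apply: eq_bigr => y /nb_lt lty.
rewrite (nth_adj_rows e x0) // sum_nb; case: (e _ _) => /=; last by rewrite big1.
rewrite -sum1_count big_mkcond big_seq [RHS]big_seq; apply: eq_bigr => z /nb_lt ltz.
by rewrite !(nth_adj_rows e x0) //; do 2 case: (e _ _).
Qed.

(** * Linear recurrences for the numbers of closed walks *)

Section Recurrence.

Local Notation N := BinNat.N.t.
Local Notation to_nat := BinNat.N.to_nat.

Fixpoint comb (cs : seq N) M v : seq N :=
  if cs is c :: cs' then
    map (fun xy => BinNat.N.add (BinNat.N.mul c xy.1) xy.2)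
      (zip v (comb cs' M (step M v)))
  else map (fun=> BinNat.N.zero) v.

Fixpoint ncomb (cs : seq N) (f : nat -> nat) j :=
  if cs is c :: cs' then to_nat c * f j + ncomb cs' f j.+1 else 0.

Lemma comb_spec (T : finType) (e : rel T) s y cs j v : enclosed e s ->
  map to_nat v = [seq nwalks e j x y | x <- s] ->
  map to_nat (comb cs (adj_rows e s) v) =
  [seq ncomb cs (fun i => nwalks e i x y) j | x <- s].
Proof.
move=> es; elim: cs j v => [|c cs IHcs] j v vE /=.
  have : size v = size s by rewrite -(size_map to_nat) vE size_map.
  by elim: v s {vE es} => [|x v IHv] [|y' s] //= [/IHv->].
have := IHcs _ _ (step_spec es vE); move: (comb _ _ _) vE => w.
elim: v w (s) => [|x v IHv] [|z w] [|y' t] //= [xE vE] [zE wE].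
rewrite Nnat.N2Nat.inj_add Nnat.N2Nat.inj_mul xE zE; congr (_ :: _).
exact: IHv.
Qed.

(** The leading coefficient is 1, so each value is determined by the [size a] values before it. *)
Lemma ncomb_recurrence a b (f f' : nat -> nat) : size b = size a ->
  (forall j, ncomb a f j + f (j + size a) = ncomb b f j) ->
  (forall j, ncomb a f' j + f' (j + size a) = ncomb b f' j) ->
  (forall j, j < size a -> f j = f' j) -> f =1 f'.
Proof.
move=> sba fR f'R f0 j; have [n] := ubnP j; elim: n j => // n IHn j ltjn.
have [/f0 // | gej] := ltnP j (size a).
have eq_ncomb cs i : i + size cs <= j -> ncomb cs f i = ncomb cs f' i.
  elim: cs i => //= c cs IHcs i lei; rewrite IHcs ?addSnnS // IHn //.
  by apply: leq_trans (ltnSE ltjn); apply: leq_trans lei; rewrite addnS ltnS leq_addr.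
have := f'R (j - size a); have := fR (j - size a).
rewrite subnK // !eq_ncomb ?sba ?subnK //.
by move=> <- /eqP; rewrite eqn_add2l => /eqP.
Qed.

Lemma ncomb_rcons a f j : ncomb (rcons a BinNat.N.one) f j =
  ncomb a f j + f (j + size a).
Proof.
elim: a j => [|c a IHa] j /=; first by rewrite mul1n addn0 addn0.
by rewrite IHa addnA addSnnS.
Qed.

(** Negative coefficients are moved to the other side, since the counts are natural numbers. The
    identity is tested on the unit vector at vertex 0 only. *)
Definition recurrence_ok a b (M : seq (seq bool)) :=
  let v := unitv (size M) 0 in
  (size b == size a) && eq_counts (comb (rcons a BinNat.N.one) M v) (comb b M v).

Lemma eq_countsE s t : eq_counts s t -> s = t.
Proof.
elim: s t => [|x s IHs] [|y t] //=.
by case: BinNat.N.eqb_spec => // -> /IHs->.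
Qed.

Lemma recurrence_nwalks (T : finType) (e : rel T) x0 s a b :
  enclosed e s -> 0 < size s -> recurrence_ok a b (adj_rows e s) ->
  let f j := nwalks e j (nth x0 s 0) (nth x0 s 0) in
  forall j, ncomb a f j + f (j + size a) = ncomb b f j.
Proof.
move=> es s_gt0 /andP[_ /eq_countsE]; rewrite size_map => combE /= j.
set y := nth x0 s 0.
(* The claim is extended to walks from any [x] in [s] to [y]: the tested vector identity is the case
   [j = 0], and prepending a step to the walks gives the others. *)
suff gen x : x \in s -> ncomb (rcons a BinNat.N.one) (fun i => nwalks e i x y) j =
    ncomb b (fun i => nwalks e i x y) j.
  by rewrite -ncomb_rcons; apply: gen; rewrite mem_nth.
have ncombS cs x0' i : ncomb cs (fun i => nwalks e i x0' y) i.+1 =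
    \sum_(z | e x0' z) ncomb cs (fun i => nwalks e i z y) i.
  elim: cs i => [|c cs IHcs] i /=; first by rewrite big1.
  by rewrite IHcs big_split /= -big_distrr.
elim: j x => [|j IHj] x xs.
  have := congr1 (map to_nat) combE.
  rewrite !(comb_spec _ es (unitv_spec e x0 es.1 s_gt0)).
  by move/eq_in_map=> /(_ x xs).
rewrite !ncombS; apply: eq_bigr => z exz; apply: IHj.
exact: es.2 exz.
Qed.

End Recurrence.

(** * Cospectral Cayley graphs that are not isomorphic *)

Definition conn_ok tb (S : seq nat) :=
  [&& all (gtn (size tb)) S, ~~ nmem 0 S
    & all (fun i => nmem (nth 0 (invs tb) i) S) S].

Definition bitmask m (S : seq nat) := map (fun i => nmem i S) (iota 0 m).

Definition set_of (gT : finGroupType) (s : seq gT) (S : seq nat) : {set gT} :=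
  [set x in [seq nth 1 s i | i <- S]].

Section SetOf.

Variables (gT : finGroupType) (s : seq gT) (tb : seq (seq nat)) (S : seq nat).
Hypotheses (sM : model s tb) (iv : has_invs tb) (conn : conn_ok tb S).

Lemma conn_lt i : i \in S -> i < size tb.
Proof. by have /and3P[/allP S_lt _ _] := conn => /S_lt. Qed.

Lemma mem_set_of i : i < size tb -> (nth 1 s i \in set_of s S) = (i \in S).
Proof.
move=> lti; have [s_uniq size_s _ _ _] := sM.
rewrite inE; apply/mapP/idP => [[j jS /eqP]|iS]; last by exists i.
by rewrite nth_uniq ?size_s // ?conn_lt // => /eqP->.
Qed.

Lemma set_of_sub : {subset set_of s S <= s}.
Proof.
have [_ size_s _ _ _] := sM.
by move=> x; rewrite inE => /mapP[i iS ->]; rewrite mem_nth ?size_s ?conn_lt.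
Qed.

Lemma mask_set_of : [seq x \in set_of s S | x <- s] = bitmask (size tb) S.
Proof.
have [_ size_s _ _ _] := sM; rewrite -[X in map _ X](mkseq_nth 1 s) -map_comp size_s.
by apply/eq_in_map=> i; rewrite mem_iota /= => lti; rewrite mem_set_of ?nmemE.
Qed.

Lemma connection_set_of : 0 < size tb -> connection_set (set_of s S).
Proof.
move=> tb_gt0; have [s_uniq size_s _ s0 _] := sM.
have /and3P[_ S0 /allP SV] := conn; split.
  by rewrite -s0 mem_set_of // -nmemE.
have sub : (set_of s S)^-1 \subset set_of s S.
  apply/subsetP=> x; rewrite inE inE => /mapP[i iS xE]; have lti := conn_lt iS.
  have [ltv vE] := nth_invs sM iv lti.
  by rewrite -[x]invgK xE -vE mem_set_of // -nmemE SV.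
by apply/eqP; rewrite eqEcard sub card_invg leqnn.
Qed.

End SetOf.

Definition table_rows tb S := lookup_rows (divt tb) (bitmask (size tb) S).

(** A common recurrence and equal initial values give equal numbers of closed walks of every length;
    different numbers of copies of [K4] exclude an isomorphism. *)
Definition pair_ok a b tb S tb' S' :=
  let M := table_rows tb S in let M' := table_rows tb' S' in
  [&& [&& 0 < size tb, has_invs tb & conn_ok tb S],
      [&& 0 < size tb', has_invs tb' & conn_ok tb' S'],
      recurrence_ok a b M && recurrence_ok a b M',
      eq_counts (walks M 0 (unitv (size M) 0) (size a))
                (walks M' 0 (unitv (size M') 0) (size a))
    & k4_rows M != k4_rows M'].

(** The tables may belong to proper subgroups: the full Cayley graphs are then disjoint copies of
    the computed ones, with the same walks and cliques at the identity. Only the orders of the two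
    groups have to agree. *)
Lemma pair_not_Cay_DS (gT hT : finGroupType) (s : seq gT) (s' : seq hT)
    a b tb S tb' S' :
  model s tb -> model s' tb' -> #|gT| = #|hT| -> pair_ok a b tb S tb' S' ->
  ~ Cay_DS gT.
Proof.
move=> sM s'M cT /and5P[/and3P[tb_gt0 iv conn] /and3P[tb'_gt0 iv' conn']].
have [_ size_s _ s0 _] := sM; have [_ size_s' _ s'0 _] := s'M.
have rowsE : adj_rows (cayley (set_of s S)) s = table_rows tb S.
  by rewrite (cayley_rows _ sM iv) (mask_set_of sM conn).
have rowsE' : adj_rows (cayley (set_of s' S')) s' = table_rows tb' S'.
  by rewrite (cayley_rows _ s'M iv') (mask_set_of s'M conn').
rewrite -rowsE -rowsE' => /andP[rec rec'] /eq_countsE walkE k4E cayDS.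
have cS := connection_set_of sM iv conn tb_gt0.
have cS' := connection_set_of s'M iv' conn' tb'_gt0.
have es := cayley_enclosed sM cS (set_of_sub sM conn).
have es' := cayley_enclosed s'M cS' (set_of_sub s'M conn').
have s_gt0 : 0 < size s by rewrite size_s.
have s'_gt0 : 0 < size s' by rewrite size_s'.
have [f bf fE] : graph_iso (cayley (set_of s S)) (cayley (set_of s' S')).
  apply: cayDS => //; apply/cospectral_nwalks.
  - by case: (cayley_simple cS).
  - by case: (cayley_simple cS').
  move=> j; rewrite !sum_nwalks_cayley cT -[in LHS]s0 -[in RHS]s'0; congr (_ * _)%N.
  have /andP[/eqP sba _] := rec.
  have fR := recurrence_nwalks 1 es s_gt0 rec.
  have f'R := recurrence_nwalks 1 es' s'_gt0 rec'.
  (* [walks] starts with length 1, so length 0 is treated apart. *)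
  apply: (ncomb_recurrence sba fR f'R) => -[|i] lti.
    by rewrite /= !eqxx.
  have := congr1 (map BinNat.N.to_nat) walkE.
  rewrite !size_map (walks_spec 1 _ es) // (walks_spec 1 _ es') //.
  move/(congr1 (nth 0 ^~ i)); rewrite !(nth_map 0) ?size_iota; try exact: ltnW.
  by rewrite nth_iota ?add1n // ltnW.
case/eqP: k4E; rewrite (k4_rows_spec 1 es) // (k4_rows_spec 1 es') // s0 s'0.
by rewrite -(k4_iso 1 bf fE) k4_cayley.
Qed.

Lemma model_pairg1 (gT hT : finGroupType) (s : seq gT) tb : model s tb ->
  0 < size tb -> model [seq (x, 1 : hT) | x <- s] tb.
Proof.
move=> [s_uniq size_s sq s0 sM] tb_gt0; split=> //.
- by rewrite map_inj_uniq // => x y [].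
- by rewrite size_map.
- by rewrite (nth_map 1) ?size_s // s0.
move=> i j lti ltj; rewrite !(nth_map 1) ?size_s ?tget_lt //.
by rewrite -sM //; congr (_, _); rewrite mulg1.
Qed.

(** The products of generators, in the numbering used by [table]. *)
Fixpoint words (gT : finGroupType) (s gs : seq gT) :=
  if gs is g :: gs' then words (s ++ [seq x * g | x <- s]) gs' else s.

Definition is_model (gT : finGroupType) (s : seq gT) tb :=
  [&& uniq s, size s == size tb, square tb, nth 1 s 0 == 1
    & all (fun i => all (fun j => nth 1 s i * nth 1 s j == nth 1 s (tget tb i j))
        (iota 0 (size tb))) (iota 0 (size tb))].

Lemma is_modelP (gT : finGroupType) (s : seq gT) tb : is_model s tb -> model s tb.
Proof.
case/and5P=> s_uniq /eqP size_s sq /eqP s0 /allP sM; split=> // i j lti ltj.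
have := sM i; rewrite mem_iota lti => /(_ isT)/allP/(_ j).
by rewrite mem_iota ltj => /(_ isT)/eqP.
Qed.

Section Mates.

Local Open Scope nat_scope.

Local Notation N_ := (BinNat.N.of_nat).

(* The Shrikhande graph on C4 x C4, a graph of degree 7 on C8 x C2, and the
   lexicographic product of the Shrikhande graph with two isolated vertices. *)
Definition mates : seq (seq (seq nat * nat) * seq nat) :=
  [:: ([:: ([::], 0); ([:: 1], 0); ([:: 1; 2], 1); ([:: 1; 2; 4], 2)],
       [:: 4; 5; 8; 10; 12; 15]);
      ([:: ([::], 0); ([:: 1], 0); ([:: 1; 2], 1); ([:: 1; 2; 4], 4)],
       [:: 1; 4; 5; 8; 10; 13; 15]);
      ([:: ([::], 0); ([:: 1], 0); ([:: 1; 2], 1); ([:: 1; 2; 4], 2);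
           ([:: 1; 2; 4; 8], 0)],
       [:: 4; 5; 8; 10; 12; 15; 20; 21; 24; 26; 28; 31])].

(* Polynomial equations satisfied by the adjacency matrices: A^3 + 24 = 4 A + 6
   A^2, A^5 + 106 A^2 = 147 + 35 A + 14 A^3 + 7 A^4, A^4 + 192 A = 16 A^2 + 12
   A^3. *)
Definition recurrences : seq (seq nat * seq nat) :=
  [:: ([:: 24; 0; 0], [:: 0; 4; 6]);
      ([:: 0; 0; 106; 0; 0], [:: 147; 35; 0; 14; 7]);
      ([:: 0; 192; 0; 0], [:: 0; 0; 16; 12])].

(* For each member of [bad32], the number of the mate and a connection set. *)
Definition witnesses : seq (nat * seq nat) :=
  [:: (1, [:: 1; 2; 3; 8; 10; 13; 15]);
      (0, [:: 2; 3; 8; 10; 13; 14]);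
      (0, [:: 1; 2; 4; 5; 8; 10]);
      (0, [:: 1; 2; 4; 6; 8; 9]);
      (0, [:: 1; 2; 4; 6; 8; 9]);
      (0, [:: 1; 2; 4; 5; 8; 10]);
      (0, [:: 1; 2; 4; 6; 8; 9]);
      (0, [:: 1; 2; 4; 5; 8; 10]);
      (1, [:: 1; 2; 3; 6; 7; 8; 9]);
      (0, [:: 2; 4; 8; 9; 10; 13]);
      (1, [:: 1; 2; 3; 8; 9; 14; 15]);
      (1, [:: 1; 2; 3; 8; 9; 12; 13]);
      (2, [:: 2; 3; 4; 5; 6; 7; 8; 9; 16; 17; 24; 25])].

Definition witness_ok d (tS : nat * seq nat) :=
  let mt := nth ([::], [::]) mates tS.1 in
  let ab := nth ([::], [::]) recurrences tS.1 in
  [&& tS.1 < 3, size (table mt.1) == size (table d)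
    & pair_ok (map N_ ab.1) (map N_ ab.2) (table d) tS.2 (table mt.1) mt.2].

Lemma witnesses_ok : all2 witness_ok bad32 witnesses.
Proof. by vm_cast_no_check (erefl true). Qed.

Lemma mate_models t : t < 3 -> exists (K : finGroupType) (s : seq K),
  let tb := table (nth ([::], [::]) mates t).1 in model s tb /\ #|K| = size tb.
Proof.
move: t => [|[|[|]]] // _.
(* The generators follow the description in [mates], where the square of a generator comes before
   the generator itself. *)
- exists ('I_4 * 'I_4)%type, (words [:: 1%g]
    [:: (inZp 2, inZp 0); (inZp 0, inZp 2); (inZp 1, inZp 0); (inZp 0, inZp 1)]).
  split; last by rewrite card_prod !card_ord.
  by apply: is_modelP; vm_cast_no_check (erefl true).
- exists ('I_8 * 'I_2)%type, (words [:: 1%g]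
    [:: (inZp 4, inZp 0); (inZp 0, inZp 1); (inZp 2, inZp 0); (inZp 1, inZp 0)]).
  split; last by rewrite card_prod !card_ord.
  by apply: is_modelP; vm_cast_no_check (erefl true).
exists ('I_4 * 'I_4 * 'I_2)%type, (words [:: 1%g]
  [:: (inZp 2, inZp 0, inZp 0); (inZp 0, inZp 2, inZp 0); (inZp 1, inZp 0, inZp 0);
      (inZp 0, inZp 1, inZp 0); (inZp 0, inZp 0, inZp 1)]).
split; last by rewrite !card_prod !card_ord.
by apply: is_modelP; vm_cast_no_check (erefl true).
Qed.

End Mates.

Lemma bad_not_Cay_DS (gT : finGroupType) d (s : seq gT) :
  d \in bad32 -> model s (table d) -> size (table d) %| #|gT| -> ~ Cay_DS gT.
Proof.
move=> dB sM div.
have [tS ok] : exists tS, witness_ok d tS.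
  have := witnesses_ok; elim: bad32 witnesses dB => // d' B IHB [|tS W] //=.
  rewrite inE => dB /andP[ok okW]; case/orP: dB => [/eqP->|dB]; first by exists tS.
  exact: IHB okW.
have /and3P[t_lt /eqP size_eq pairP] := ok.
have [K [s' [s'M cK]]] := mate_models t_lt.
have /and5P[_ /and3P[tb'_gt0 _ _] _ _ _] := pairP.
have /dvdnP[q qE] := div.
have q_gt0 : 0 < q.
  by rewrite lt0n; apply/eqP=> q0; have := cardG_gt0 [set: gT]; rewrite cardsT qE q0.
(* A cyclic factor of order [q] brings the group of the mate to the order of [gT]; the successor
   form gives ['I_q] its group structure. *)
have s''M := model_pairg1 'I_q.-1.+1 s'M tb'_gt0.
apply: (pair_not_Cay_DS sM s''M _ pairP).
by rewrite card_prod card_ord prednK // cK size_eq qE mulnC.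
Qed.

(** * Cayley graphs of the two good groups *)

(** Undecided bits never conflict. With [invs] as [s], this detects an element whose inverse was
    decided the other way. *)
Fixpoint differ (p q : seq bool) (s : seq nat) :=
  match p, s with
  | b :: p', j :: s' =>
    if onth q j is Some c then if eqb b c then differ p' q s' else true
    else differ p' q s'
  | _, _ => false
  end.

Lemma differP p q s : differ p q s ->
  exists i b c, [/\ i < size s, onth p i = Some b, onth q (nth 0 s i) = Some c & b != c].
Proof.
elim: p s => [|b p IHp] [|j s] //= dif.
have tail : differ p q s -> exists i b' c, [/\ i < (size s).+1,
    onth (b :: p) i = Some b', onth q (nth 0 (j :: s) i) = Some c & b' != c].
  by case/IHp=> i [b' [c [lti pi qi bc]]]; exists i.+1, b', c.
case qj: (onth q j) dif => [c|//]; case: ifP => [//|/(eqbP b c)/eqP bc _].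
by exists 0, b, c.
Qed.

(** On 16 vertices a regular graph or its complement has degree at most 7, hence the bound. *)
Definition cayley_bad iv L (p : seq bool) :=
  if 7 < count id p then true else
  if differ p p iv then true else lhas (lex_lt p p) L.

(** Strings start with [false] because the identity, number 0, is not in a connection set. *)
Definition cayley_leaves (d : seq (seq nat * nat)) (auts : seq (seq nat)) :=
  let tb := table d in
  leaves (cayley_bad (invs tb) (map (gens_map tb) auts)) (size tb).-1 [:: false].

Definition auts_ok d auts :=
  all (fun hs => embedding (table d) (table d) (gens_map (table d) hs)) auts.

(** [lex_max] is applied to the enumerations of the group that realize the table: [S] stays fixed,
    and an automorphism of the table changes the enumeration. *)
Lemma mem_cayley_leaves (gT : finGroupType) (S : {set gT}) (s0 : seq gT) d auts :
  connection_set S -> #|S| <= 7 -> has_invs (table d) -> auts_ok d auts ->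
  model s0 (table d) -> (forall x, x \in s0) ->
  exists s : seq gT, [/\ model s (table d), forall x, x \in s
    & [seq x \in S | x <- s] \in cayley_leaves d auts].
Proof.
move=> [S1 SV] leS iv /allP autP s0M s0_all.
pose P (s : seq gT) := model s (table d) /\ forall x, x \in s.
have [||s [sM s_all] lex_s] := @lex_max _ P (fun s => [seq x \in S | x <- s])
  (size (table d)) (map (gens_map (table d)) auts) _ _ s0 (conj s0M s0_all).
- by move=> s [[_ size_s _ _ _] _]; rewrite size_map.
- move=> s _ [sM s_all] /mapP[hs /autP emb ->].
  have [s_uniq size_s sq _ _] := sM.
  have /and5P[/eqP size_g _ /allP g_lt _ _] := emb; split=> //.
  have yM := embedding_model sM sq emb.
  exists [seq nth 1 s i | i <- gens_map (table d) hs].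
    split=> // x; have [y_uniq size_y _ _ _] := yM.
    have [||_ ->] := uniq_min_size y_uniq (s2 := s) => //.
    by rewrite size_y size_s.
  rewrite -map_comp; apply/eq_in_map=> i /g_lt lti /=.
  by rewrite (nth_map 1) ?size_s.
exists s; split=> //; have [s_uniq size_s _ s1 _] := sM.
have codeE : [seq x \in S | x <- s] = false :: behead [seq x \in S | x <- s].
  case: (s) s1 (s_all 1) => //= x t -> _.
  by rewrite (negPf S1).
rewrite codeE -cat1s; apply: mem_leaves; first by rewrite size_behead size_map size_s.
move=> i; rewrite cat1s -codeE /cayley_bad.
have cnt : count id [seq x \in S | x <- s] = #|S|.
  rewrite count_map cardE /enum_mem size_filter -enumT.
  apply/seq.permP; rewrite uniq_perm ?enum_uniq // => x.
  by rewrite mem_enum s_all.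
rewrite ltnNge (_ : count id _ <= 7) /=; last first.
  apply: leq_trans leS; rewrite -cnt -[X in _ <= count _ X](cat_take_drop i).
  by rewrite count_cat leq_addr.
have -> : differ (take i [seq x \in S | x <- s]) (take i [seq x \in S | x <- s])
    (invs (table d)) = false.
  apply/negP=> /differP[j [b [c [ltj jb jc]]]].
  rewrite size_map in ltj; have [ltv vE] := nth_invs sM iv ltj.
  have := @onth_nth _ false _ _ _ (onth_take jb).
  have := @onth_nth _ false _ _ _ (onth_take jc).
  rewrite !(nth_map 1) ?size_s // vE -{1}SV mem_invg invgK => -> ->.
  by rewrite eqxx.
by rewrite lhasE; apply/hasPn=> t tL; apply: lex_s.
Qed.

Section AutData.

Local Open Scope nat_scope.

(* Images of the generators 1, 2, 4, 8 under some automorphisms of the members of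
   [groups16]; more automorphisms prune the enumeration better. *)
Definition bad_auts : seq (seq (seq nat)) :=
  [:: [:: [:: 1; 3; 4; 10]; [:: 1; 2; 4; 9]; [:: 1; 2; 4; 10]; [:: 1; 3; 4; 8]];
      [:: [:: 1; 3; 5; 10]; [:: 1; 2; 4; 9]; [:: 1; 2; 4; 15]; [:: 1; 2; 5; 10]];
      [:: [:: 2; 3; 8; 12]; [:: 1; 3; 4; 13]; [:: 1; 2; 7; 9]; [:: 2; 1; 9; 5];
          [:: 1; 2; 4; 9]];
      [:: [:: 1; 4; 7; 10]; [:: 1; 2; 6; 14]; [:: 1; 2; 5; 12]; [:: 1; 3; 4; 10]];
      [:: [:: 1; 3; 8; 7]; [:: 1; 2; 4; 10]; [:: 1; 2; 5; 9]; [:: 1; 2; 9; 4];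
          [:: 1; 2; 6; 9]; [:: 1; 3; 4; 8]; [:: 1; 2; 4; 9]];
      [:: [:: 1; 3; 7; 12]; [:: 1; 2; 5; 11]; [:: 1; 2; 4; 9]; [:: 1; 2; 6; 8];
          [:: 1; 3; 4; 14]];
      [:: [:: 2; 1; 4; 8]; [:: 1; 4; 8; 2]; [:: 1; 2; 5; 8]; [:: 1; 2; 13; 8];
          [:: 1; 2; 4; 9]; [:: 1; 3; 4; 8]; [:: 1; 2; 4; 11]; [:: 1; 2; 8; 4];
          [:: 1; 2; 4; 12]; [:: 1; 2; 7; 8]];
      [:: [:: 1; 2; 6; 12]; [:: 1; 2; 4; 9]; [:: 1; 2; 4; 13]; [:: 1; 2; 5; 8]];
      [:: [:: 1; 9; 14; 4]; [:: 1; 2; 5; 15]; [:: 1; 4; 2; 9]; [:: 1; 2; 4; 9];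
          [:: 1; 8; 15; 4]; [:: 1; 3; 4; 14]];
      [:: [:: 1; 4; 3; 14]; [:: 1; 2; 5; 14]; [:: 1; 3; 4; 15]; [:: 1; 2; 4; 9]];
      [:: [:: 1; 2; 5; 10]; [:: 1; 2; 4; 9]; [:: 1; 2; 5; 11]; [:: 1; 3; 6; 12]];
      [:: [:: 1; 2; 5; 12]; [:: 1; 2; 4; 10]; [:: 1; 2; 4; 14]; [:: 1; 2; 4; 12]]].

Definition good_auts : seq (seq (seq nat)) :=
  [:: [:: [:: 1; 3; 8; 13]; [:: 1; 2; 7; 12]; [:: 1; 2; 5; 11]; [:: 1; 2; 12; 6];
          [:: 1; 2; 8; 4]];
      [:: [:: 1; 9; 5; 14]; [:: 1; 2; 4; 15]; [:: 1; 3; 5; 9]; [:: 1; 2; 4; 9];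
          [:: 1; 8; 4; 2]]].

Definition auts16 := bad_auts ++ good_auts.

Definition leaf_rows (da : seq (seq nat * nat) * seq (seq nat)) :=
  let D := divt (table da.1) in map (lookup_rows D) (cayley_leaves da.1 da.2).

(** Vertex 0 is enough by vertex-transitivity, and length 8 is enough for [good_check] to
    succeed. *)
Definition walk_key (M : seq (seq bool)) := walks M 0 (unitv (size M) 0) 8.

Definition keyed_rows da := [seq (walk_key M, M) | M <- leaf_rows da].

Definition good_check :=
  let good := [seq (c.1, numbered c.2)
              | c <- flatten (map keyed_rows (zip good16 good_auts))] in
  lall (fun da => lall (fun c => lall (fun c' =>
    if eq_counts c'.1 c.1 then iso_search c.2 c'.2 [::] else true) good)
    (keyed_rows da)) (zip groups16 auts16).

End AutData.

Lemma auts16_ok : [&& all2 auts_ok groups16 auts16, all2 auts_ok good16 good_auts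
  & all (fun d => has_invs (table d)) groups16].
Proof. by vm_cast_no_check (erefl true). Qed.

Lemma good_checked : good_check.
Proof. by vm_cast_no_check (erefl true). Qed.

Lemma good_check_iso k1 k2 M1 M2 :
  (k2, M2) \in flatten (map keyed_rows (zip groups16 auts16)) ->
  (k1, M1) \in flatten (map keyed_rows (zip good16 good_auts)) ->
  eq_counts k1 k2 -> iso_search M2 (numbered M1) [::].
Proof.
have := good_checked; rewrite /good_check lallE.
move: (flatten (map keyed_rows (zip good16 _))) (zip groups16 _) => L1 L2.
move=> /allP ck /flattenP[_ /mapP[da daG ->] k2in] k1in k12.
have := ck da daG; rewrite lallE => /allP/(_ _ k2in); rewrite lallE => /allP.
by move/(_ _ (map_f (fun c => (c.1, numbered c.2)) k1in)); rewrite /= k12.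
Qed.

Lemma graph_iso_sym (T T' : finType) (e : rel T) (e' : rel T') :
  graph_iso e e' -> graph_iso e' e.
Proof.
case=> f [g fK gK] fE; exists g; first by exists f.
by move=> x y; rewrite -fE !gK.
Qed.

Lemma zip_auts D A d : all2 auts_ok D A -> d \in D ->
  exists2 a, (d, a) \in zip D A & auts_ok d a.
Proof.
elim: D A => // d' D IHD [|a A] // /andP[ok okA].
rewrite inE => /orP[/eqP-> | /(IHD _ okA)[a' mem ok']].
  by exists a; rewrite ?mem_head.
by exists a'; rewrite // inE mem orbT.
Qed.

(** Cospectrality gives [hT] order 16, so it is one of the fourteen groups, and suitable
    enumerations put both graphs in the checked lists. *)
Lemma good_iso_small (gT hT : finGroupType) (S : {set gT}) (S' : {set hT}) d
    (s0 : seq gT) :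
  #|gT| = 16 -> d \in good16 -> model s0 (table d) -> (forall x, x \in s0) ->
  connection_set S -> connection_set S' -> #|S| <= 7 -> #|S'| <= 7 ->
  cospectral (cayley S) (cayley S') -> graph_iso (cayley S) (cayley S').
Proof.
move=> cG dgood s0M s0_all cS cS' leS leS' cos.
have cH : #|hT| = 16.
  by rewrite -cG -(size_spectrum (cayley S)) (perm_size cos) size_spectrum.
have [eS eS'] := (cayley_simple cS, cayley_simple cS').
have nwE j : nwalks (cayley S) j 1 1 = nwalks (cayley S') j 1 1.
  have := (cospectral_nwalks eS.1 eS'.1).1 cos j.
  by rewrite !sum_nwalks_cayley cG cH => /eqP; rewrite eqn_mul2l => /eqP.
have [d' [t0 [d'G t0M t0_mem]]] : exists d' (t0 : seq hT),
    [/\ d' \in groups16, model t0 (table d') & [set: hT] =i t0].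
  by apply: (@classification _ [set: hT]%G 4); rewrite ?cardsT.
have t0_all x : x \in t0 by rewrite -t0_mem inE.
have dG : d \in groups16 by rewrite mem_cat dgood orbT.
have /and3P[oks goks /allP ivs] := auts16_ok.
have [a mem ok] := zip_auts goks dgood; have iv := ivs _ dG.
have [a' mem' ok'] := zip_auts oks d'G; have iv' := ivs _ d'G.
have [s [sM s_all s_leaf]] := mem_cayley_leaves cS leS iv ok s0M s0_all.
have [t [tM t_all t_leaf]] := mem_cayley_leaves cS' leS' iv' ok' t0M t0_all.
have key (kT : finGroupType) (X : {set kT}) D A e b (u : seq kT) :
    (e, b) \in zip D A -> has_invs (table e) -> model u (table e) ->
    [seq x \in X | x <- u] \in cayley_leaves e b ->
    (walk_key (adj_rows (cayley X) u), adj_rows (cayley X) u)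
      \in flatten (map keyed_rows (zip D A)).
  move=> ebDA ive uM leaf; apply/flattenP; exists (keyed_rows (e, b)).
    exact: map_f.
  by apply: map_f; rewrite (cayley_rows _ uM ive); apply: map_f.
have keyE : eq_counts (walk_key (adj_rows (cayley S) s))
                      (walk_key (adj_rows (cayley S') t)).
  have [_ size_s _ s1 _] := sM; have [_ size_t _ t1 _] := tM.
  have s_gt0 : 0 < size s by rewrite -has_predT; apply/hasP; exists 1; first exact: s_all.
  have t_gt0 : 0 < size t by rewrite -has_predT; apply/hasP; exists 1; first exact: t_all.
  have es := cayley_enclosed sM cS (fun x _ => s_all x).
  have et := cayley_enclosed tM cS' (fun x _ => t_all x).
  apply: eq_countsP; rewrite /walk_key !size_map.
  rewrite (walks_spec 1 8 es s_gt0) (walks_spec 1 8 et t_gt0).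
  by apply: eq_map => j; rewrite s1 t1 nwE.
apply: graph_iso_sym; have [s_uniq size_s _ _ _] := sM; have [t_uniq size_t _ _ _] := tM.
apply: (graph_iso_rows 1 eS' eS t_uniq t_all s_uniq s_all).
  have card_all (U : finType) (u : seq U) : uniq u -> (forall x, x \in u) ->
      #|U| = size u.
    by move=> u_uniq u_all; rewrite -(card_uniqP u_uniq); apply: eq_card => x;
       rewrite u_all.
  by rewrite -(card_all _ _ t_uniq t_all) -(card_all _ _ s_uniq s_all) cG cH.
apply: iso_searchP; apply: good_check_iso keyE.
  exact: key mem' iv' tM t_leaf.
exact: key mem iv sM s_leaf.
Qed.

Lemma cospectral_eq (T T' : finType) (e1 e2 : rel T) (e1' e2' : rel T') :
  e1 =2 e2 -> e1' =2 e2' -> cospectral e1 e1' -> cospectral e2 e2'.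
Proof.
have spec (U : finType) (f g : rel U) : f =2 g -> spectrum f = spectrum g.
  move=> fg; rewrite /spectrum; congr (sval (closed_field_poly_normal (char_poly _))).
  by apply/matrixP=> i j; rewrite !mxE fg.
by move=> e12 e12'; rewrite /cospectral (spec _ _ _ e12) (spec _ _ _ e12').
Qed.

(** Degrees above 7 are reduced by complements; the complement of a Cayley graph is the Cayley graph
    of the remaining elements other than 1. *)
Lemma good_Cay_DS (gT : finGroupType) d (s : seq gT) : #|gT| = 16 ->
  d \in good16 -> model s (table d) -> (forall x, x \in s) -> Cay_DS gT.
Proof.
move=> cG dgood sM s_all S cS hT S' cS' cos.
have [eS eS'] := (cayley_simple cS, cayley_simple cS').
have cH : #|hT| = 16.
  by rewrite -cG -(size_spectrum (cayley S)) (perm_size cos) size_spectrum.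
have regS := cayley_regular S.
have regS' := cospectral_regular eS.1 eS'.1 regS cos.
have SS' : #|S'| = #|S| by rewrite -(regS' 1) (cayley_regular S').
have [leS|gtS] := leqP #|S| 7.
  by apply: (good_iso_small cG dgood sM s_all) => //; rewrite SS'.
have complE (kT : finGroupType) (X : {set kT}) :
    graph_compl (cayley X) =2 cayley (~: (1 |: X)).
  by move=> x y; rewrite /graph_compl /cayley !inE negb_or -eq_mulgV1.
have complC (kT : finGroupType) (X : {set kT}) : connection_set X ->
    connection_set (~: (1 |: X)).
  case=> X1 XV; split; first by rewrite !inE eqxx.
  by apply/setP=> x; rewrite mem_invg !in_setC !in_setU1 invg_eq1 -mem_invg XV.
have card_compl (kT : finGroupType) (X : {set kT}) : connection_set X -> #|kT| = 16 ->
    #|X| = #|S| -> #|~: (1 |: X)| <= 7.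
  case=> X1 _ cK XS; rewrite cardsCs setCK cardsU1 X1 cK XS add1n leq_subLR addSnnS.
  exact: (leq_add gtS (leqnn 8)).
apply: (graph_iso_compl eS.2 eS'.2).
have [f bf fE] : graph_iso (cayley (~: (1 |: S))) (cayley (~: (1 |: S'))).
  apply: (good_iso_small cG dgood sM s_all); try exact: complC.
  - exact: card_compl.
  - exact: card_compl.
  apply: (cospectral_eq (complE _ _) (complE _ _)).
  exact: (cospectral_compl eS eS' regS regS' cos).
by exists f => // x y; rewrite !complE.
Qed.

(** * Presentations *)

Definition add_new (l : seq nat) y := if nmem y l then l else y :: l.

Fixpoint closure_by (tb : seq (seq nat)) (gs : seq nat) n l :=
  if n is n'.+1 then
    closure_by tb gs n' (foldl add_new l [seq tget tb x g | x <- l, g <- gs])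
  else l.

(** The list is checked to be closed under multiplication by [gs], so nothing has to be known about
    the iteration that produced it. *)
Definition not_generated tb gs :=
  let l := closure_by tb gs (size tb) [:: 0] in
  [&& nmem 0 l, all (fun x => all (fun g => nmem (tget tb x g) l) gs) l,
      all (gtn (size tb)) l & size l < size tb].

Lemma not_generatedP (gT : finGroupType) (s : seq gT) tb gs :
  model s tb -> (forall x, x \in s) -> all (gtn (size tb)) gs ->
  not_generated tb gs ->
  <<[set x in [seq nth 1 s i | i <- gs]]>> != [set: gT].
Proof.
move=> [s_uniq size_s sq s0 sM] s_all /allP gs_lt; rewrite /not_generated.
move: (closure_by _ _ _ _) => l /and4P[l0 /allP l_cl /allP l_lt size_l].
have sub x : x \in <<[set x in [seq nth 1 s i | i <- gs]]>> ->
    x \in [seq nth 1 s i | i <- l].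
  case/gen_prodgP=> n [c cP ->] {x}; elim: n c cP => [|n IHn] c cP.
    by rewrite big_ord0; apply/mapP; exists 0; rewrite -?nmemE ?s0.
  rewrite big_ord_recr /=.
  have /mapP[i il ->] := IHn (fun i => c (widen_ord (leqnSn n) i)) (fun i => cP _).
  have := cP ord_max; rewrite inE => /mapP[j jg ->].
  rewrite sM; [|exact: l_lt|exact: gs_lt].
  by apply: map_f; rewrite -nmemE; apply: (allP (l_cl i il)).
apply: contraTneq size_l => genT; rewrite -leqNgt -size_s.
rewrite -(size_map (nth 1 s) l); apply: uniq_leq_size => // x _.
by apply: sub; rewrite genT inE.
Qed.

Lemma closure_by_gen (gT : finGroupType) (K : {group gT}) (s : seq gT) tb gs n l :
  model s tb -> all (gtn (size tb)) gs -> all (gtn (size tb)) l ->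
  {in gs, forall i, nth 1 s i \in K} -> {in l, forall i, nth 1 s i \in K} ->
  {in closure_by tb gs n l, forall i, nth 1 s i \in K}.
Proof.
move=> [s_uniq size_s sq s0 sM] /allP gs_lt + gsK.
elim: n l => //= n IHn l /allP l_lt lK.
suff [lt' K'] : all (gtn (size tb)) (foldl add_new l [seq tget tb x g | x <- l, g <- gs])
   /\ {in foldl add_new l [seq tget tb x g | x <- l, g <- gs],
         forall i, nth 1 s i \in K} by apply: IHn.
have : {in [seq tget tb x g | x <- l, g <- gs], forall y,
    y < size tb /\ nth 1 s y \in K}.
  move=> _ /allpairsP[[x g] /= [xl gg ->]]; split; first by apply: tget_lt (l_lt x xl).
  rewrite -sM; [|exact: l_lt|exact: gs_lt].
  exact: groupM (lK x xl) (gsK g gg).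
move: [seq tget tb x g | x <- l, g <- gs] => t.
elim: t l l_lt lK => [|y t IHt] l l_lt lK tP /=.
  by split=> //; apply/allP.
have [lty yK] := tP y (mem_head _ _).
have {}tP : {in t, forall y, y < size tb /\ nth 1 s y \in K}.
  by move=> z zt; apply: tP; rewrite inE zt orbT.
rewrite /add_new; case: ifP => _; apply: IHt => // z.
  by rewrite inE => /orP[/eqP->|/l_lt].
by rewrite inE => /orP[/eqP->|/lK].
Qed.

Definition table_generated tb gs :=
  all (fun i => nmem i (closure_by tb gs (size tb) [:: 0])) (iota 0 (size tb)).

Lemma join3_gen (gT : finGroupType) (a b c : gT) :
  <[a]> <*> <[b]> <*> <[c]> = <<[set x in [:: a; b; c]]>>.
Proof.
apply/eqP; rewrite eqEsubset !join_subG !cycle_subG gen_subG !mem_gen ?inE ?eqxx ?orbT //=.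
apply/subsetP=> x; rewrite !inE => /or3P[] /eqP->.
- by rewrite (subsetP (joing_subl _ _)) // (subsetP (joing_subl _ _)) ?cycle_id.
- by rewrite (subsetP (joing_subl _ _)) // (subsetP (joing_subr _ _)) ?cycle_id.
by rewrite (subsetP (joing_subr _ _)) ?cycle_id.
Qed.

Lemma table_generatedP (gT : finGroupType) (s : seq gT) tb i j k :
  model s tb -> (forall x, x \in s) -> all (gtn (size tb)) [:: i; j; k] ->
  table_generated tb [:: i; j; k] ->
  <[nth 1 s i]> <*> <[nth 1 s j]> <*> <[nth 1 s k]> = [set: gT].
Proof.
move=> sM s_all lt gen; have [_ size_s _ s0 _] := sM.
rewrite join3_gen; set K := <<_>>%g; apply/eqP; rewrite eqEsubset subsetT /=.
apply/subsetP=> x _; have /(nthP 1)[l ltl <-] := s_all x.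
have tb_gt0 : 0 < size tb by rewrite -size_s; apply: leq_ltn_trans ltl.
apply: (@closure_by_gen _ [group of K] s tb [:: i; j; k] (size tb) [:: 0]) => //.
- by rewrite /= tb_gt0.
- by move=> y ys; rewrite mem_gen // inE (map_f (nth 1 s) ys).
- by move=> y; rewrite inE => /eqP->; rewrite s0 group1.
by rewrite -nmemE; apply: (allP gen); rewrite mem_iota -size_s.
Qed.

(** The relations are freed of inverses: [a^2 b^2 = 1], [b^4 = 1] and [b a b = a] replace
    [a^2 = b^-2], [b^2 = b^-2] and [a^-1 b a = b^-1]. *)
Definition relC2xQ8 tb i j k :=
  let m := tget tb in
  if eqn (m k k) 0 then if eqn (m (m i i) (m j j)) 0 then
  if eqn (m (m j j) (m j j)) 0 then if eqn (m (m j i) j) i then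
  if eqn (m i k) (m k i) then eqn (m j k) (m k j)
  else false else false else false else false else false.

Definition relC4oD8 tb i j k :=
  let m := tget tb in
  if eqn (m i i) 0 then if eqn (m j j) 0 then
  if eqn (m (m k k) (m k k)) 0 then if eqn (m k k) (m (m j i) (m j i)) then
  if eqn (m i k) (m k i) then eqn (m j k) (m k j)
  else false else false else false else false else false.

(** If no triple satisfying the relations generates the group, the group is not even a quotient of
    the presented one. *)
Definition excluded (r : seq (seq nat) -> nat -> nat -> nat -> bool) d :=
  let tb := table d in let I := iota 0 (size tb) in
  lall (fun i => lall (fun j => lall (fun k =>
    if r tb i j k then not_generated tb [:: i; j; k] else true) I) I) I.

Lemma bad16_excluded : all (excluded relC2xQ8) bad16 && all (excluded relC4oD8) bad16.
Proof. by vm_cast_no_check (erefl true). Qed.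

(** In the first group, 3 is a central involution that is not a square; in the second, 5 is a
    central element of order 4. *)
Lemma good_generated :
  [&& relC2xQ8 (table gC2xQ8) 15 11 3, table_generated (table gC2xQ8) [:: 15; 11; 3],
      relC4oD8 (table gC4oD8) 15 9 5 & table_generated (table gC4oD8) [:: 15; 9; 5]].
Proof. by vm_cast_no_check (erefl true). Qed.

Section TableRelations.

Variables (gT : finGroupType) (s : seq gT) (tb : seq (seq nat)) (i j k : nat).
Hypotheses (sM : model s tb) (lti : i < size tb) (ltj : j < size tb).
Hypothesis ltk : k < size tb.

Local Notation a := (nth 1 s i).
Local Notation b := (nth 1 s j).
Local Notation c := (nth 1 s k).

Lemma table_eq x y : x < size tb -> y < size tb ->
  eqn x y = (nth 1 s x == nth 1 s y).
Proof. by have [s_uniq size_s _ _ _] := sM => ltx lty; rewrite nth_uniq ?size_s. Qed.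

Lemma relC2xQ8E : relC2xQ8 tb i j k =
  [&& c * c == 1, a * a * (b * b) == 1, b * b * (b * b) == 1, b * a * b == a,
      a * c == c * a & b * c == c * b].
Proof.
have [_ _ sq s0 mulE] := sM.
have tb_gt0 : 0 < size tb by apply: leq_ltn_trans ltk.
have lt x y : x < size tb -> tget tb x y < size tb by apply: tget_lt.
have lts := (lt _ _ lti, lt _ _ ltj, lt _ _ ltk).
rewrite /relC2xQ8 !table_eq ?lts ?lt ?lts // -!mulE ?lts // s0.
by repeat case: (_ == _).
Qed.

Lemma relC4oD8E : relC4oD8 tb i j k =
  [&& a * a == 1, b * b == 1, c * c * (c * c) == 1, c * c == b * a * (b * a),
      a * c == c * a & b * c == c * b].
Proof.
have [_ _ sq s0 mulE] := sM.
have tb_gt0 : 0 < size tb by apply: leq_ltn_trans ltk.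
have lt x y : x < size tb -> tget tb x y < size tb by apply: tget_lt.
have lts := (lt _ _ lti, lt _ _ ltj, lt _ _ ltk).
rewrite /relC4oD8 !table_eq ?lts ?lt ?lts // -!mulE ?lts // s0.
by repeat case: (_ == _).
Qed.

End TableRelations.

Lemma excludedP (gT : finGroupType) (s : seq gT) d r
    (R : gT -> gT -> gT -> Prop) a b c :
  model s (table d) -> (forall x, x \in s) -> excluded r d ->
  (forall i j k, i < size (table d) -> j < size (table d) -> k < size (table d) ->
     R (nth 1 s i) (nth 1 s j) (nth 1 s k) -> r (table d) i j k) ->
  R a b c -> <[a]> <*> <[b]> <*> <[c]> != [set: gT].
Proof.
move=> sM s_all ex rP; have [_ size_s _ _ _] := sM.
have /(nthP 1)[i lti <-] := s_all a; have /(nthP 1)[j ltj <-] := s_all b.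
have /(nthP 1)[k ltk <-] := s_all c; rewrite size_s in lti ltj ltk.
move/(rP i j k lti ltj ltk) => rijk; rewrite join3_gen.
apply: (@not_generatedP _ s (table d) [:: i; j; k]) => //.
  by rewrite /= lti ltj ltk.
have mem x : x < size (table d) -> x \in iota 0 (size (table d)).
  by rewrite mem_iota.
move: ex; rewrite /excluded lallE => /allP/(_ i (mem i lti)).
rewrite lallE => /allP/(_ j (mem j ltj)); rewrite lallE => /allP/(_ k (mem k ltk)).
by rewrite rijk.
Qed.

(** The commuting [<c>] and [<a>] have a product of order at most 4 * 2, which [b] normalizes since
    [a ^ b = c^2 a]; the factor [<b>] at most doubles the order. *)
Lemma C4oD8_bound (gT : finGroupType) (a b c : gT) :
  a ^+ 2 = 1 -> b ^+ 2 = 1 -> c ^+ 4 = 1 -> a * c = c * a -> b * c = c * b ->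
  c ^+ 2 = (b * a) ^+ 2 -> #|<[a]> <*> <[b]> <*> <[c]>| <= 16.
Proof.
move=> a2 b2 c4 ac bc cba.
have le_cycle (x : gT) m : 0 < m -> x ^+ m = 1 -> #|<[x]>| <= m.
  by move=> m_gt0 xm; rewrite dvdn_leq // order_dvdn xm.
have le_mul (X Y : {group gT}) m p : #|X| <= m -> #|Y| <= p -> #|X * Y| <= m * p.
  move=> leX leY; apply: leq_trans (leq_mul leX leY).
  by rewrite mul_cardG leq_pmulr // cardG_gt0.
have abE : a ^ b = c ^+ 2 * a.
  have b1 : b^-1 = b by apply/eqP; rewrite eq_invg_mul -expg2 b2.
  rewrite cba expg2 /conjg b1 !mulgA.
  by rewrite -(mulgA _ a a) -expg2 a2 mulg1.
pose X := (<[c]> <*> <[a]>)%G.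
have leX : #|X| <= 4 * 2.
  rewrite /= cent_joinEl ?le_mul ?le_cycle //.
  by rewrite cent_cycle cycle_subG; apply/cent1P.
have nXb : <[b]> \subset 'N(X).
  rewrite cycle_subG inE /= conjYg -!cycleJ join_subG !cycle_subG abE.
  have cX : c \in X by rewrite (subsetP (joing_subl _ _)) ?cycle_id.
  have aX : a \in X by rewrite (subsetP (joing_subr _ _)) ?cycle_id.
  by rewrite /conjg -bc mulKg cX groupM ?groupX.
rewrite (joingC _ <[c]>) joingA -[<[c]> <*> <[a]>]/(gval X) norm_joinEr //.
by apply: (le_mul _ _ 8 2) => //; apply: le_cycle.
Qed.

Definition presC2xQ8 (gT : finGroupType) (a b c : gT) :=
  [&& c ^+ 2 == 1, a ^+ 2 == b ^- 2, b ^+ 2 == b ^- 2, a^-1 * b * a == b^-1,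
      a * c == c * a & b * c == c * b].

Definition presC4oD8 (gT : finGroupType) (a b c : gT) :=
  [&& a ^+ 2 == 1, b ^+ 2 == 1, c ^+ 4 == 1, c ^+ 2 == (b * a) ^+ 2,
      a * c == c * a & b * c == c * b].

Lemma relC2xQ8_eqs (gT : finGroupType) (a b c : gT) :
  [&& c * c == 1, a * a * (b * b) == 1, b * b * (b * b) == 1, b * a * b == a,
      a * c == c * a & b * c == c * b] =
  presC2xQ8 a b c.
Proof.
have sqE (x : gT) : (x * x * (b * b) == 1) = (x ^+ 2 == b ^- 2).
  by rewrite [RHS]eq_mulgV1 invgK !expg2.
have conjE : (b * a * b == a) = (a^-1 * b * a == b^-1).
  by rewrite [RHS]eq_mulgV1 invgK -!mulgA [LHS]eq_sym eq_mulVg1.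
by rewrite /presC2xQ8 !sqE conjE expg2.
Qed.

Lemma relC4oD8_eqs (gT : finGroupType) (a b c : gT) :
  [&& a * a == 1, b * b == 1, c * c * (c * c) == 1, c * c == b * a * (b * a),
      a * c == c * a & b * c == c * b] =
  presC4oD8 a b c.
Proof. by rewrite /presC4oD8 -!expg2 -expgM. Qed.

(** Generators with these relations make the group a quotient of [C2xQ8], and the orders agree. *)
Lemma isog_C2xQ8P (gT : finGroupType) : #|gT| = 16 ->
  [set: gT] \isog [set: C2xQ8] <->
  exists a b c : gT, <[a]> <*> <[b]> <*> <[c]> = [set: gT] /\
    presC2xQ8 a b c.
Proof.
move=> cG; split=> [isoG | [a [b [c [genG rel]]]]].
  have := isog_hom isoG; rewrite (Grp_C2xQ8 [set: gT]%G).
  case/existsP=> -[[a b] c] /eqP[defG c2 ab bb ba ac bc].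
  exists a, b, c; split=> //.
  by apply/and5P; split; try (apply/andP; split); apply/eqP.
have homG : [set: gT] \homg [set: C2xQ8].
  case/and5P: rel => /eqP c2 /eqP ab /eqP bb /eqP ba /andP[/eqP ac /eqP bc].
  rewrite (Grp_C2xQ8 [set: gT]%G); apply/existsP; exists (a, b, c) => /=.
  by rewrite !xpair_eqE genG c2 ab ba ac bc !eqxx -bb !eqxx.
have cQ : #|[set: quaternion_gtype 8]| = 8 := @card_quaternion 3 isT.
by rewrite isogEcard homG /= !cardsT cG card_prod card_ord -cardsT cQ.
Qed.

Lemma isoGrp_C4oD8P (gT : finGroupType) : #|gT| = 16 ->
  [set: gT] \isog Grp (a : b : c :
           a ^+ 2 = 1, b ^+ 2 = 1, c ^+ 4 = 1,
           a * c = c * a, b * c = c * b, c ^+ 2 = (b * a) ^+ 2) <->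
  exists a b c : gT, <[a]> <*> <[b]> <*> <[c]> = [set: gT] /\
    presC4oD8 a b c.
Proof.
move=> cG; split=> [isoG | [a [b [c [genG]]]]].
  have /existsP[[[a b] c] /eqP[defG a2 b2 c4 ac bc cba]] := @isoGrp_hom _ [set: gT]%G _ isoG.
  exists a, b, c; split=> //.
  by apply/and5P; split; try (apply/andP; split); apply/eqP.
case/and5P=> /eqP a2 /eqP b2 /eqP c4 /eqP cba /andP[/eqP ac /eqP bc].
apply: (@intro_isoGrp _ [set: gT]%G).
  apply/existsP; exists (a, b, c) => /=.
  by rewrite !xpair_eqE genG a2 b2 c4 ac bc cba !eqxx.
(* The subgroup of [gT * H] generated by the pairs of generators satisfies the
   relations, hence has at most 16 elements and projects isomorphically to [gT]. *)
move=> rT H /existsP[[[x y] z] /eqP[defH x2 y2 z4 xz yz zyx]].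
pose u : gT * rT := (a, x); pose v : gT * rT := (b, y); pose w : gT * rT := (c, z).
pose D := (<[u]> <*> <[v]> <*> <[w]>)%G.
have leD : #|D| <= 16.
  by apply: C4oD8_bound; congr (_, _).
have imY (kT : finGroupType) (f : {morphism [set: gT * rT] >-> kT}) :
    f @* D = <[f u]> <*> <[f v]> <*> <[f w]>.
  by rewrite !morphimY ?subsetT // !morphim_cycle ?inE.
have im1 : [morphism of fst] @* D = [set: gT] by rewrite imY /=.
have im2 : [morphism of snd] @* D = H by rewrite imY /=.
have isoD : D \isog [set: gT].
  have homD : [set: gT] \homg D by rewrite -im1; exact: morphim_homg (subsetT _).
  by rewrite isog_sym isogEcard homD /= cardsT cG.
apply: homg_trans (isog_hom isoD); rewrite -im2.
exact: morphim_homg (subsetT _).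
Qed.

(** * The three ranges of orders *)

Lemma bad32_dvd : all (fun d => size (table d) %| 32) bad32.
Proof. by vm_cast_no_check (erefl true). Qed.

Lemma pgroup_sub (gT : finGroupType) (G : {group gT}) n k : #|G| = (2 ^ n)%N ->
  k <= n -> exists2 H : {group gT}, H \subset G & #|H| = (2 ^ k)%N.
Proof.
move=> cG lekn; have pG : 2.-group G by rewrite /pgroup cG pnatX.
have [H [sHG _ cH]] : exists H : {group gT},
    [/\ H \subset G, H <| G & #|H| = (2 ^ k)%N].
  by apply: (normal_pgroup pG (normal_refl G)); rewrite cG pfactorK.
by exists H.
Qed.

Lemma DS_small (gT : finGroupType) n :
  (1 <= n)%N -> #|gT| = (2 ^ n)%N -> (n <= 3)%N -> DS gT.
Proof.
move=> n_gt0 cG len S cS T e eS cos.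
apply: (@cospectral_regular_iso (2 ^ n)%N #|S|) => //.
- by move: n n_gt0 len {cG} => [|[|[|[|n]]]].
- exact: cayley_simple.
exact: cayley_regular.
Qed.

(** Take subgroups [H] of order 16 inside [K] of order 32. A bad [H] settles the case at once; over
    a good [H], the extension check finds a member of [bad32] inside [K]. *)
Lemma not_Cay_DS_large (gT : finGroupType) n :
  #|gT| = (2 ^ n)%N -> (5 <= n)%N -> ~ Cay_DS gT.
Proof.
move=> cG le5n; rewrite -cardsT in cG.
have [K sKG cK] := pgroup_sub cG le5n.
have [H sHK cH] := pgroup_sub cK (isT : 4 <= 5).
have dvd d : d \in bad32 -> size (table d) %| #|gT|.
  move=> dB; apply: dvdn_trans (allP bad32_dvd d dB) _.
  by rewrite -cardsT cG (dvdn_exp2l 2 le5n).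
have [d [s [dG sM Hs]]] := classification (isT : 4 <= 4) cH.
have : d \in bad16 ++ good16 by exact: dG.
rewrite mem_cat => /orP[dbad | dgood].
  have dB : d \in bad32 by rewrite mem_rcons inE dbad orbT.
  exact: bad_not_Cay_DS dB sM (dvd d dB).
have iKH : #|K : H| = 2 by rewrite -divgS // cK cH.
have /andP[wf _] := data_well_formed.
have [||d' [s' [d'B s'M _]]] :=
  classify_step sHK iKH _ _ classify_check32 dgood sM Hs.
- apply/allP=> d1 d1G; apply: (allP wf); rewrite mem_cat; apply/orP; right.
  apply/flattenP; exists groups16; last by rewrite mem_cat d1G orbT.
  by rewrite !inE eqxx !orbT.
- by apply/allP=> d1 d1B; apply: (allP wf); rewrite mem_cat d1B.
exact: bad_not_Cay_DS d'B s'M (dvd d' d'B).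
Qed.

(** The presentations are matched against the fourteen tables: each good table has generators with
    the relations of its presentation, and no bad table has such generators for either. *)
Lemma Cay_DS16 (gT : finGroupType) : #|gT| = 16 ->
  Cay_DS gT <->
    [set: gT] \isog [set: C2xQ8] \/
    [set: gT] \isog Grp (a : b : c :
      a ^+ 2 = 1, b ^+ 2 = 1, c ^+ 4 = 1,
      a * c = c * a, b * c = c * b, c ^+ 2 = (b * a) ^+ 2).
Proof.
move=> cG; rewrite isog_C2xQ8P // isoGrp_C4oD8P //.
have [d [s [dG sM Gs]]] : exists d (s : seq gT),
    [/\ d \in bad16 ++ good16, model s (table d) & [set: gT] =i s].
  by apply: (@classification _ [set: gT]%G 4); rewrite ?cardsT.
have s_all x : x \in s by rewrite -Gs inE.
have [s_uniq size_s _ _ _] := sM.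
have size_tb : size (table d) = 16.
  by rewrite -size_s -(card_uniqP s_uniq) -cG; apply: eq_card => x; rewrite s_all.
move: dG; rewrite mem_cat => dG.
split=> [cayDS | rels].
  case/orP: dG => [dbad | dgood].
    have dB : d \in bad32 by rewrite mem_rcons inE dbad orbT.
    have dv : size (table d) %| #|gT| by rewrite size_tb cG.
    by case: (bad_not_Cay_DS dB sM dv cayDS).
  have /and4P[relQ genQ relD genD] := good_generated.
  move: dgood; rewrite !inE => /orP[] /eqP dE; rewrite dE in sM size_tb; [left|right].
    exists (nth 1 s 15), (nth 1 s 11), (nth 1 s 3); split.
      by apply: table_generatedP sM s_all _ genQ; rewrite size_tb.
    by rewrite -relC2xQ8_eqs -(relC2xQ8E sM) ?size_tb.
  exists (nth 1 s 15), (nth 1 s 9), (nth 1 s 5); split.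
    by apply: table_generatedP sM s_all _ genD; rewrite size_tb.
  by rewrite -relC4oD8_eqs -(relC4oD8E sM) ?size_tb.
have /andP[/allP exQ /allP exD] := bad16_excluded.
case/orP: dG => [dbad | dgood]; last exact: good_Cay_DS cG dgood sM s_all.
case: rels => -[a [b [c [genG rel]]]].
  have rP i j k (lti : i < size (table d)) (ltj : j < size (table d))
      (ltk : k < size (table d)) :
      presC2xQ8 (nth 1 s i) (nth 1 s j) (nth 1 s k) -> relC2xQ8 (table d) i j k.
    by rewrite -relC2xQ8_eqs -(relC2xQ8E sM).
  have := excludedP (R := fun x y z => presC2xQ8 x y z) sM s_all (exQ d dbad) rP rel.
  by rewrite genG eqxx.
have rP i j k (lti : i < size (table d)) (ltj : j < size (table d))
    (ltk : k < size (table d)) :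
    presC4oD8 (nth 1 s i) (nth 1 s j) (nth 1 s k) -> relC4oD8 (table d) i j k.
  by rewrite -relC4oD8_eqs -(relC4oD8E sM).
have := excludedP (R := fun x y z => presC4oD8 x y z) sM s_all (exD d dbad) rP rel.
by rewrite genG eqxx.
Qed.

Theorem theorem4p3 (gT : finGroupType) (n : nat) :
  (1 <= n)%N -> #|gT| = (2 ^ n)%N ->
  [/\ (n <= 3)%N -> DS gT,
      n = 4 ->
        (Cay_DS gT <->
         [set: gT] \isog [set: C2xQ8] \/
         [set: gT] \isog Grp (a : b : c :
           a ^+ 2 = 1, b ^+ 2 = 1, c ^+ 4 = 1,
           a * c = c * a, b * c = c * b, c ^+ 2 = (b * a) ^+ 2))
    & (5 <= n)%N -> ~ Cay_DS gT].
Proof.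
move=> n_gt0 cG; split=> [|n4|]; first exact: DS_small.
  by apply: Cay_DS16; rewrite cG n4.
exact: not_Cay_DS_large.
Qed.
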